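(* Let $W$ be an affine Weyl group with associated finite Weyl group $\mathring W$. Each choice of $q_1,q_2\in\mathbb{C}$ such that $q_1,q_2\ne0$ and $q:=-\frac{q_1}{q_2}$ is not a $k$-th root of unity for any integer $1\le k\le2\,\mathrm{ht}(\theta^\vee)$ determines in the Hecke group algebra $\mathrm{H}\mathring W$ a maximal decomposition of the identity into (orthogonal) idempotents, namely $1=\sum_{w\in\mathring W}p_w$, where $p_w\in\mathrm{End}(\mathbb{C}\mathring W)$ is the projection onto $\mathbb{C}E_w$ which kills all $E_{w'}$, $w'\ne w$; in particular all $p_w$ belong to $\mathrm{H}\mathring W$. Here $(E_w)_{w\in\mathring W}$ is the basis of $\mathbb{C}\mathring W$, unique up to rescaling, such that $E_w.Y^{\lambda^\vee}=q^{-\mathrm{ht}(w(\lambda^\vee))}E_w$ for all $w\in\mathring W$ and all $\lambda^\vee$ in the coroot lattice of $\mathring W$, where $Y^{\lambda^\vee}\in \mathrm{H}(W)(q_1,q_2)$ acts through the level $0$ representation.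
   Context: Affine Weyl group. Let $M=(a_{i,j})_{i,j\in I}$, $I=\{0,\dots,n\}$, $n\ge1$, be an indecomposable generalized Cartan matrix of affine type (twisted or untwisted) and $W=\langle s_i\mid i\in I\rangle$ its affine Weyl group. Let $\mathfrak h^*=\bigoplus_{i\in I}\mathbb{R}\alpha_i$ and let $\mathfrak h=\bigoplus_{i\in I}\mathbb{R}\Lambda_i^\vee$ be its dual, $\langle\Lambda^\vee_i,\alpha_j\rangle=\delta_{ij}$; put $\alpha_i^\vee=\sum_j a_{i,j}\Lambda_j^\vee$. $W$ acts on $\mathfrak h$ by $s_i(x)=x-\langle x,\alpha_i\rangle\alpha_i^\vee$ and on $\mathfrak h^*$ by $s_i(y)=y-\langle\alpha_i^\vee,y\rangle\alpha_i$. Let $\delta=\sum_i a_i\alpha_i$, where the $a_i$ are the positive coprime integers with $\sum_j a_{i,j}a_j=0$ for all $i$. $W$ stabilizes each $\mathfrak h^\ell=\{x\in\mathfrak h\mid\langle x,\delta\rangle=\ell\}$. $\mathring W$ is the (finite) image of $W$ in $GL(\mathfrak h^0)$, and $\mathrm{cl}:W\to\mathring W$ is the quotient map; nodes are labelled so that $\mathrm{cl}$ restricts to an isomorphism from $\langle s_1,\dots,s_n\rangle$ onto $\mathring W$, through which these are identified. $\mathring W$ has roots $\mathring R=\{w(\alpha_i)\mid w\in\mathring W,1\le i\le n\}$, positive roots $\mathring R^+$, simple coroots $\alpha_1^\vee,\dots,\alpha_n^\vee$ and coroot lattice $\mathring R^\vee_{\mathbb Z}=\bigoplus_{i=1}^n\mathbb{Z}\alpha_i^\vee$.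 The height of $\lambda^\vee=\sum_{i=1}^n\lambda_i\alpha_i^\vee$ is $\mathrm{ht}(\lambda^\vee)=\sum_i\lambda_i$; $\theta^\vee$ is the highest coroot of $\mathring W$. Alcoves. The reflections of $W$ are the maps $x\mapsto x-\langle x,\alpha-m\delta\rangle\alpha^\vee$ for $\alpha\in\mathring R^+$ and $m\in c_\alpha\mathbb{Z}$, with certain $c_\alpha\in\mathbb{Q}_{>0}$ ($c_\alpha=1$ in untwisted types); put $c(\lambda^\vee)=\sum_ic_{\alpha_i}\lambda_i\alpha_i^\vee$. $W$ contains the translation $t_{\lambda^\vee}:x\mapsto x+\langle x,\delta\rangle c(\lambda^\vee)$, and $W=\mathring W\ltimes\{t_{\lambda^\vee}\}$. For $w\in\mathring W$, $w(\lambda^\vee)$ is the element of the coroot lattice with $wt_{\lambda^\vee}w^{-1}=t_{w(\lambda^\vee)}$ (in untwisted types this is the usual action). Fix $\ell>0$. The fundamental alcove is $A=\{x\in\mathfrak h^\ell\mid\langle x,\alpha_i\rangle>0\ \forall i\in I\}$. An alcove walk $i_1,\dots,i_r$ from $A$ to $w(A)$ is a sequence with $w=s_{i_1}\cdots s_{i_r}$, giving alcoves $A,s_{i_1}(A),\dots,s_{i_1}\cdots s_{i_r}(A)$; its $k$-th step crosses a hyperplane $\{x\in\mathfrak h^\ell\mid\langle x,\alpha\rangle=\ell m\}$ with $\alpha\in\mathring R^+$, and $\epsilon_k=1$ if it goes to the side $\langle x,\alpha\rangle>\ell m$, $\epsilon_k=-1$ otherwise. Affine Hecke algebra. $\mathrm{H}(W)(q_1,q_2)$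 is the $\mathbb{C}$-algebra generated by $T_i$, $i\in I$, subject to $(T_i-q_1)(T_i-q_2)=0$ and the braid relations of $W$. For $\lambda^\vee\in\mathring R^\vee_{\mathbb Z}$, $Y^{\lambda^\vee}:=(-q_1q_2)^{-\mathrm{ht}(\lambda^\vee)}T_{i_1}^{\epsilon_1}\cdots T_{i_r}^{\epsilon_r}$ for any alcove walk $i_1,\dots,i_r$ from $A$ to $t_{\lambda^\vee}(A)$ (independent of the walk). Level $0$ representation and Hecke group algebra. Let $\mathring\rho^\vee\in\mathfrak h^0$ be the half sum of the positive coroots of $\mathring W$. On $\mathbb{C}\mathring W$ (basis $\mathring W$), operators act on the right: $w.s_i=w\,\mathrm{cl}(s_i)$; $w.\pi_i=w\,\mathrm{cl}(s_i)$ if $\langle w^{-1}(\mathring\rho^\vee),\alpha_i\rangle>0$ and $w.\pi_i=w$ otherwise ($i\in I$). $T_i$ acts as $(q_1+q_2)\pi_i-q_1s_i$. The Hecke group algebra $\mathrm{H}\mathring W$ is the unital subalgebra of $\mathrm{End}(\mathbb{C}\mathring W)$ generated by $s_1,\dots,s_n,\pi_1,\dots,\pi_n$. A decomposition of the identity into orthogonal non-zero idempotents is maximal if none of the idempotents is a sum of two non-zero orthogonal idempotents of the algebra. It is known, under the stated conditions on $q_1,q_2$, that a basis $(E_w)$ as in the statement exists and that the characters $\lambda^\vee\mapsto q^{-\mathrm{ht}(w(\lambda^\vee))}$, $w\in\mathring W$, are pairwise distinct. *)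

(* Defs.v *)
From HB Require Import structures.
From mathcomp Require Import all_boot all_order all_fingroup all_algebra.
From mathcomp Require Import complex.
From mathcomp Require Import boolp classical_sets reals.

Set Implicit Arguments.
Unset Strict Implicit.
Unset Printing Implicit Defensive.
Import Order.TTheory GRing.Theory Num.Theory.
Local Open Scope ring_scope.
Local Open Scope classical_set_scope.

(* The real space h has coordinates in the basis (Lambda_i^vee) and consists of
   column vectors; its dual h* has coordinates in the basis (alpha_i) and
   consists of row vectors.  A linear map g of h is a square matrix acting by
   x |-> g *m x, and contragrediently on h* by y |-> y *m g^-1.
   The node 0 is ord0 and the nodes 1, ..., n are the lift ord0 i, i : 'I_n. *)

Section CartanMatrix.
Variable n : nat.
Implicit Type A : 'M[int]_n.+1.

Definition gcm A : Prop :=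
  [/\ forall i, A i i = 2,
      forall i j, i != j -> A i j <= 0 &
      forall i j, A i j = 0 -> A j i = 0].

Definition indecomposable A : Prop :=
  forall J : {set 'I_n.+1}, (exists i, i \in J) -> (exists j, j \notin J) ->
    exists i j, [/\ i \in J, j \notin J & A i j != 0].

(* Kac's trichotomy, case (Aff). *)
Definition affine_type (R : realType) A : Prop :=
  let B : 'M[R]_n.+1 := map_mx intr A in
  [/\ \rank B = n,
      exists u : 'cV[R]_n.+1, (forall i, 0 < u i 0) /\ B *m u = 0 &
      forall v : 'cV[R]_n.+1, (forall i, 0 <= (B *m v) i 0) -> B *m v = 0].

Definition null_marks A (a : 'I_n.+1 -> nat) : Prop :=
  [/\ forall i, (0 < a i)%N,
      \big[gcdn/0%N]_i a i = 1%N &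
      forall i, \sum_j A i j * (a j)%:Z = 0].

Definition ht (lam : 'rV[int]_n) : int := \sum_i lam 0 i.

End CartanMatrix.

Section AffineWeylGroup.
Variables (R : realType) (n : nat) (A : 'M[int]_n.+1) (a : 'I_n.+1 -> nat).

Definition pairing (x : 'cV[R]_n.+1) (y : 'rV[R]_n.+1) : R := (y *m x) 0 0.

Definition simple_root (i : 'I_n.+1) : 'rV[R]_n.+1 := delta_mx 0 i.
Definition simple_coroot (i : 'I_n.+1) : 'cV[R]_n.+1 :=
  \col_j (A i j)%:~R.
Definition delta : 'rV[R]_n.+1 := \row_j (a j)%:R.

(* x |-> x - <x, y> v *)
Definition reflection (v : 'cV[R]_n.+1) (y : 'rV[R]_n.+1) : 'M[R]_n.+1 :=
  1 - v *m y.

Definition srefl (i : 'I_n.+1) : 'M[R]_n.+1 :=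
  reflection (simple_coroot i) (simple_root i).

Definition weyl_group : set 'M[R]_n.+1 :=
  [set g | exists s : seq 'I_n.+1, g = \prod_(i <- s) srefl i].

Definition parabolic : set 'M[R]_n.+1 :=
  [set g | exists s : seq 'I_n, g = \prod_(i <- s) srefl (lift ord0 i)].

Definition eq_on_h0 (g h : 'M[R]_n.+1) : Prop :=
  forall x : 'cV[R]_n.+1, pairing x delta = 0 -> g *m x = h *m x.

(* The finite group W0 is the image of W in GL(h^0), identified by means of r
   with <s_1, ..., s_n>: the last two clauses say that restriction to h^0 maps
   <s_1, ..., s_n> bijectively onto the image of W. *)
Definition finite_weyl_group (W0 : finGroupType) (r : W0 -> 'M[R]_n.+1)
    : Prop :=
  [/\ injective r,
      forall u v, r (u * v)%g = r u *m r v,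
      range r = parabolic,
      forall g h, parabolic g -> parabolic h -> eq_on_h0 g h -> g = h &
      forall g, weyl_group g -> exists2 h, parabolic h & eq_on_h0 g h].

Variables (W0 : finGroupType) (r : W0 -> 'M[R]_n.+1).

Definition cl (g : 'M[R]_n.+1) : W0 := xget 1%g [set u | eq_on_h0 (r u) g].

(* The pairs (root of W0, its coroot), without repetition. *)
Definition root_pairs : seq ('rV[R]_n.+1 * 'cV[R]_n.+1) :=
  undup [seq (simple_root (lift ord0 i) *m r (u^-1)%g,
              r u *m simple_coroot (lift ord0 i))
        | u <- enum W0, i <- enum 'I_n].

Definition pos_root_pairs : seq ('rV[R]_n.+1 * 'cV[R]_n.+1) :=
  [seq p : 'rV[R]_n.+1 * 'cV[R]_n.+1 <- root_pairs | [forall j, 0 <= p.1 0 j]].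

Definition rho_vee : 'cV[R]_n.+1 := 2^-1 *: \sum_(p <- pos_root_pairs) p.2.

(* Elements of the coroot lattice of W0 are given by their coordinates on
   alpha_1^vee, ..., alpha_n^vee. *)
Definition coroot_vec (lam : 'rV[int]_n) : 'cV[R]_n.+1 :=
  \sum_i (lam 0 i)%:~R *: simple_coroot (lift ord0 i).

Definition is_coroot (lam : 'rV[int]_n) : Prop :=
  exists2 p, p \in root_pairs & p.2 = coroot_vec lam.

Definition highest_coroot (theta : 'rV[int]_n) : Prop :=
  is_coroot theta /\
  forall mu, is_coroot mu -> forall i, mu 0 i <= theta 0 i.

(* c gives the spacing of the reflection hyperplanes of W in each direction. *)
Definition reflection_spacing (c : 'rV[R]_n.+1 -> rat) : Prop :=
  (forall p, p \in pos_root_pairs -> 0 < c p.1) /\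
  forall g : 'M[R]_n.+1,
    (exists w i, weyl_group w /\ g = w * srefl i * w^-1) <->
    (exists p (k : int), p \in pos_root_pairs /\
      g = reflection p.2 (p.1 - (ratr (c p.1) * k%:~R) *: delta)).

Variable c : 'rV[R]_n.+1 -> rat.

Definition c_vec (lam : 'rV[int]_n) : 'cV[R]_n.+1 :=
  \sum_i (ratr (c (simple_root (lift ord0 i))) * (lam 0 i)%:~R)
           *: simple_coroot (lift ord0 i).

(* t_lam : x |-> x + <x, delta> c(lam) *)
Definition translation (lam : 'rV[int]_n) : 'M[R]_n.+1 :=
  1 + c_vec lam *m delta.

(* w(lam), which differs from the linear action on coroot_vec lam when c is not
   constant. *)
Definition coroot_act (w : W0) (lam : 'rV[int]_n) : 'rV[int]_n :=
  xget 0 [set mu | r w * translation lam * (r w)^-1 = translation mu].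

Variable l : R.

Definition fund_alcove : set 'cV[R]_n.+1 :=
  [set x | pairing x delta = l /\ forall i, 0 < pairing x (simple_root i)].

(* The step from u(A) to u s_i(A) goes to the side <x, alpha> > l m of the
   hyperplane that it crosses, i.e. that separates these two alcoves. *)
Definition positive_step (u : 'M[R]_n.+1) (i : 'I_n.+1) : Prop :=
  exists (p : 'rV[R]_n.+1 * 'cV[R]_n.+1) (m : R),
    [/\ p \in pos_root_pairs,
        forall x, fund_alcove x -> pairing (u *m x) p.1 < l * m &
        forall x, fund_alcove x -> l * m < pairing (u *m srefl i *m x) p.1].

Definition alcove_walk (g : 'M[R]_n.+1) (s : seq 'I_n.+1) : Prop :=
  g = \prod_(i <- s) srefl i.

End AffineWeylGroup.

Section AffineHeckeAlgebra.
Variables (R : realType) (n : nat) (A : 'M[int]_n.+1) (a : 'I_n.+1 -> nat).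
Local Notation C := R[i].
Variables (q1 q2 : C).

Definition alternating_prod (B : nzRingType) (m : nat) (x y : B) : B :=
  \prod_(k < m) (if odd k then y else x).

(* Order of g; no m qualifies if g has infinite order. *)
Definition has_order (g : 'M[R]_n.+1) (m : nat) : Prop :=
  [/\ (0 < m)%N, g ^+ m = 1 & forall k, (0 < k < m)%N -> g ^+ k <> 1].

Definition hecke_relations (B : algType C) (t : 'I_n.+1 -> B) : Prop :=
  (forall i, (t i - q1%:A) * (t i - q2%:A) = 0) /\
  (forall i j m, i != j -> has_order (srefl R A i * srefl R A j) m ->
     alternating_prod m (t i) (t j) = alternating_prod m (t j) (t i)).

(* H, with the elements T i, is the algebra presented by these generators and
   relations. *)
Definition affine_hecke_algebra (H : algType C) (T : 'I_n.+1 -> H) : Prop :=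
  hecke_relations T /\
  forall (B : algType C) (t : 'I_n.+1 -> B), hecke_relations t ->
    exists f : {lrmorphism H -> B},
      (forall i, f (T i) = t i) /\
      forall g : {lrmorphism H -> B}, (forall i, g (T i) = t i) -> g =1 f.

Variables (H : algType C) (T : 'I_n.+1 -> H).

Definition Tinv (i : 'I_n.+1) : H := (q1 * q2)^-1 *: ((q1 + q2)%:A - T i).

Lemma TinvP : q1 != 0 -> q2 != 0 -> hecke_relations T ->
  forall i, T i * Tinv i = 1 /\ Tinv i * T i = 1.
Proof.
move=> q1n0 q2n0 [quad _] i; have q12 : q1 * q2 != 0 by rewrite mulf_neq0.
have eqT : T i * T i = (q1 + q2) *: T i - (q1 * q2)%:A.
  apply/eqP; rewrite -subr_eq0 -(quad i) mulrBl !mulrBr -!scalerAl !mul1r.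
  rewrite -!scalerAr !mulr1 scalerA scalerDl !opprD !opprK !addrA.
  by rewrite (addrAC (T i * T i)).
by split; rewrite /Tinv -?scalerAr -?scalerAl ?(mulrBr, mulrBl) -?scalerAr
  -?scalerAl ?(mulr1, mul1r) eqT opprB addrC subrK scalerA mulVf ?scale1r.
Qed.

Variables (W0 : finGroupType) (r : W0 -> 'M[R]_n.+1).
Variables (c : 'rV[R]_n.+1 -> rat) (l : R).

(* T_{i_1}^{eps_1} ... T_{i_r}^{eps_r} for the walk s starting from u(A). *)
Fixpoint walk_prod (u : 'M[R]_n.+1) (s : seq 'I_n.+1) : H :=
  if s is i :: s' then
    (if `[< positive_step A a r l u i >] then T i else Tinv i)
      * walk_prod (u * srefl R A i) s'
  else 1.

(* Y^lam, computed along some alcove walk from A to t_lam(A); it does not depend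
   on that walk. *)
Definition Y (lam : 'rV[int]_n) : H :=
  (- (q1 * q2)) ^ (- ht lam) *:
  walk_prod 1 (xget [::] [set s | alcove_walk A (translation A a c lam) s]).

End AffineHeckeAlgebra.

Section LevelZero.
Variables (R : realType) (n : nat) (A : 'M[int]_n.+1) (a : 'I_n.+1 -> nat).
Variables (W0 : finGroupType) (r : W0 -> 'M[R]_n.+1).
Local Notation C := R[i].
Local Notation N := #|W0|.

(* C W0 is 'rV[C]_N, on which End(C W0) = 'M[C]_N acts on the right; the
   composite "first X, then Y" is X *m Y. *)
Definition group_vec (w : W0) : 'rV[C]_N := delta_mx 0 (enum_rank w).

Definition basis_op (f : W0 -> W0) : 'M[C]_N :=
  \matrix_k group_vec (f (enum_val k)).

Definition s_op (i : 'I_n.+1) : 'M[C]_N :=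
  basis_op (fun w => w * cl a r (srefl R A i))%g.

Definition pi_op (i : 'I_n.+1) : 'M[C]_N :=
  basis_op (fun w =>
    if 0 < pairing (r (w^-1)%g *m rho_vee A r) (simple_root R i)
    then (w * cl a r (srefl R A i))%g else w).

Definition is_subalgebra (S : set 'M[C]_N) : Prop :=
  [/\ S 1%:M,
      forall (z : C) X X', S X -> S X' -> S (z *: X + X') &
      forall X X', S X -> S X' -> S (X *m X')].

Definition hecke_group_algebra : set 'M[C]_N :=
  smallest is_subalgebra
    [set X | exists i : 'I_n, X = s_op (lift ord0 i) \/ X = pi_op (lift ord0 i)].

Definition idempotent_decomposition (S : set 'M[C]_N) (p : W0 -> 'M[C]_N)
    : Prop :=
  [/\ forall w, S (p w) /\ p w != 0,
      forall w, p w *m p w = p w,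
      forall w w', w != w' -> p w *m p w' = 0 &
      \sum_w p w = 1%:M].

Definition maximal_idempotent_decomposition (S : set 'M[C]_N)
    (p : W0 -> 'M[C]_N) : Prop :=
  idempotent_decomposition S p /\
  forall w e f, S e -> S f -> e != 0 -> f != 0 ->
    e *m e = e -> f *m f = f -> e *m f = 0 -> f *m e = 0 -> p w <> e + f.

Variables (c : 'rV[R]_n.+1 -> rat) (l : R) (q1 q2 : C).
Variables (H : algType C) (T : 'I_n.+1 -> H).
Variable rho : {lrmorphism H -> 'M[C]_N}.

Definition level0_representation : Prop :=
  forall i, rho (T i) = (q1 + q2) *: pi_op i - q1 *: s_op i.

Definition Y_eigenbasis (E : W0 -> 'rV[C]_N) : Prop :=
  basis_of fullv (codom E) /\
  forall w lam,
    E w *m rho (Y A a q1 q2 T r c l lam) =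
      (- (q1 / q2)) ^ (- ht (coroot_act A a r c w lam)) *: E w.

End LevelZero.

(* Main.v *)
Require Import Defs.
From HB Require Import structures.
From mathcomp Require Import all_boot all_order all_fingroup all_algebra.
From mathcomp Require Import complex.
From mathcomp Require Import boolp classical_sets reals.
From mathcomp Require Import ring lra zify.

(* The operators of the Y^lam share the eigenbasis (E_w), so the projection p_w
   is a Lagrange interpolation product in the Y^lam as soon as their joint
   eigenvalues are pairwise distinct; having rank one, p_w does not split.

   The Y^lam act inside the Hecke group algebra.  The only doubtful generator
   is T_0; but on h^0 the root alpha_0 is a positive multiple of u(alpha_m) for
   some u in the finite group and m >= 1, and then pi_0 is the conjugate of pi_m
   under the right translation by u.

   Distinctness of the characters.  Take j with c_(alpha_j) minimal.  The
   coefficients of w(alpha_j^vee) for the twisted action are c_j b_i / c_i,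
   where the b_i are those of an ordinary coroot, so their height is at most
   ht(theta^vee) in absolute value.  As q is not a root of unity of order
   <= 2 ht(theta^vee), equal characters of w and w' force equal heights on the
   whole orbit of alpha_j^vee, which spans by irreducibility.  Hence w w'^-1
   fixes the functional c(lam) |-> ht(lam), which is strictly dominant, so
   w = w'.  The triviality of the stabilizer is proved with Mozes' numbers game:
   reflecting negative coordinates is confluent (rank 2) and terminates, so an
   orbit contains a single dominant element. *)

Set Implicit Arguments.
Unset Strict Implicit.
Unset Printing Implicit Defensive.
Import Order.TTheory GRing.Theory Num.Theory.
Local Open Scope ring_scope.

(** * The pairing of [h] with its dual, and reflections acting on both sides *)

Section Pairing.
Variables (R : realType) (n : nat).
Implicit Types (x v : 'cV[R]_n.+1) (y : 'rV[R]_n.+1).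

Lemma pairingDr x y y' : pairing x (y + y') = pairing x y + pairing x y'.
Proof. by rewrite /pairing mulmxDl mxE. Qed.

Lemma pairingBr x y y' : pairing x (y - y') = pairing x y - pairing x y'.
Proof. by rewrite /pairing mulmxBl !mxE. Qed.

Lemma pairingZr x k y : pairing x (k *: y) = k * pairing x y.
Proof. by rewrite /pairing -scalemxAl mxE. Qed.

Lemma pairingBl x x' y : pairing (x - x') y = pairing x y - pairing x' y.
Proof. by rewrite /pairing mulmxBr !mxE. Qed.

Lemma pairingZl k x y : pairing (k *: x) y = k * pairing x y.
Proof. by rewrite /pairing -scalemxAr mxE. Qed.

Lemma pairing_suml (I : Type) (s : seq I) (P : pred I)
    (F : I -> 'cV[R]_n.+1) y :
  pairing (\sum_(i <- s | P i) F i) y = \sum_(i <- s | P i) pairing (F i) y.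
Proof. by rewrite /pairing mulmx_sumr summxE. Qed.

Lemma pairing_mulmx (g : 'M[R]_n.+1) x y :
  pairing (g *m x) y = pairing x (y *m g).
Proof. by rewrite /pairing mulmxA. Qed.

Lemma pairing_simple_root x i : pairing x (simple_root R i) = x i 0.
Proof. by rewrite /pairing /simple_root -rowE mxE. Qed.

Lemma mul_reflection y' v y : y' *m reflection v y = y' - pairing v y' *: y.
Proof.
rewrite /reflection mulmxBr mulmx1 mulmxA [y' *m v]mx11_scalar.
by rewrite mul_scalar_mx.
Qed.

Lemma reflection_mul v y x : reflection v y *m x = x - pairing x y *: v.
Proof.
rewrite /reflection mulmxBl mul1mx -mulmxA [y *m x]mx11_scalar.
by rewrite mul_mx_scalar.
Qed.

End Pairing.

(** * Consequences of affine type: independence of proper sets of coroots, and rank 2 bounds *)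

Section Cartan.
Variables (R : realType) (n : nat) (A : 'M[int]_n.+1) (a : 'I_n.+1 -> nat).
Hypotheses (gcmA : gcm A) (indA : indecomposable A) (marks : null_marks A a).

Lemma pairing_simple i j :
  pairing (simple_coroot R A i) (simple_root R j) = (A i j)%:~R.
Proof. by rewrite pairing_simple_root mxE. Qed.

Lemma pairing_simple2 i :
  pairing (simple_coroot R A i) (simple_root R i) = 2.
Proof. by rewrite pairing_simple; case: gcmA => ->. Qed.

Lemma pairing_coroot_delta i : pairing (simple_coroot R A i) (delta R a) = 0.
Proof.
case: marks => _ _ /(_ i) S0; rewrite /pairing mxE.
apply: etrans (_ : (\sum_j A i j * (a j)%:Z)%:~R = 0); last by rewrite S0.
by rewrite rmorph_sum; apply: eq_bigr => j _; rewrite !mxE /= intrM mulrC.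
Qed.

Lemma srefl_invol i : srefl R A i *m srefl R A i = 1%:M.
Proof.
rewrite /srefl {1}/reflection mulmxBl mul1mx -mulmxA.
rewrite mul_reflection pairing_simple2 scaler_nat mulr2n opprD addrA subrr.
by rewrite sub0r mulmxN opprK subrK.
Qed.

(** A maximum principle. Replacing each [x i] by its absolute value makes every column sum [S j]
    non-positive, because only the diagonal of [A] is positive. Weighted by the marks these sums add
    up to 0, so each of them vanishes, and indecomposability spreads the zero of [x] from node 0. *)
Lemma simple_coroot_free (x : 'I_n.+1 -> R) :
  x ord0 = 0 -> \sum_i x i *: simple_coroot R A i = 0 -> forall i, x i = 0.
Proof.
case: gcmA => A2 Aneg _; case: marks => a_gt0 _ Aa0 x0 sum0.
have col0 j : \sum_i x i * (A i j)%:~R = 0.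
  have := congr1 (fun M : 'cV_n.+1 => M j 0) sum0; rewrite summxE mxE.
  by apply: etrans; apply: eq_bigr => i _; rewrite !mxE.
pose S j := \sum_i `|x i| * (A i j)%:~R.
have S_le0 j : S j <= 0.
  rewrite /S (bigD1 j) //= A2.
  have /eqP := col0 j; rewrite (bigD1 j) //= A2 addr_eq0 => /eqP xj.
  have: `|x j * 2%:~R| <= \sum_(i | i != j) - (`|x i| * (A i j)%:~R).
    rewrite xj normrN; apply: le_trans (ler_norm_sum _ _ _) _.
    apply: ler_sum => i ij; rewrite normrM -mulrN.
    by rewrite (ler0_norm (x := _%:~R)) // lerz0 Aneg.
  by rewrite normrM (gtr0_norm (x := 2%:~R)) ?ltr0z // sumrN; lra.
have sumS : \sum_j (a j)%:R * S j = 0.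
  transitivity (\sum_i `|x i| * (\sum_j A i j * (a j)%:Z)%:~R).
    rewrite /S; under eq_bigr => j _ do rewrite mulr_sumr.
    rewrite exchange_big /=; apply: eq_bigr => i _.
    rewrite rmorph_sum mulr_sumr; apply: eq_bigr => j _.
    by rewrite /= intrM mulrC -mulrA.
  by apply: big1 => i _; rewrite Aa0 mulr0.
have S0 j : S j = 0.
  have: 0 <= (a j)%:R * S j.
    have := sumS; rewrite (bigD1 j) //= => /eqP; rewrite addr_eq0 => /eqP ->.
    rewrite oppr_ge0; apply: sumr_le0 => k _.
    by apply: mulr_ge0_le0 => //; rewrite ler0n.
  by rewrite pmulr_rge0 ?ltr0n // => ?; apply/le_anti/andP.
move=> i; apply/eqP/negPn/negP => xi.
(* An edge leaving the support of [x]. Since [x m] is zero, [S m] has no positive term, so the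
   equality [S m = 0] kills the term of [k]. *)
have [||k [m [/[!inE] xk /negPn/eqP xm Akm]]] := @indA [set i | x i != 0].
- by exists i; rewrite inE.
- by exists ord0; rewrite inE x0 eqxx.
have km : k != m by apply: contraNneq xk => ->; rewrite xm.
suff : `|x k| * (A k m)%:~R = 0.
  by move/eqP; rewrite mulf_eq0 normr_eq0 (negPf xk) intr_eq0 (negPf Akm).
have term_le0 p : `|x p| * (A p m)%:~R <= 0.
  have [->|pm] := eqVneq p m; first by rewrite xm normr0 mul0r.
  by apply: mulr_ge0_le0; rewrite ?normr_ge0 // lerz0 Aneg.
have := S0 m; rewrite /S (bigD1 k) //= => /eqP; rewrite addr_eq0 => /eqP Sk.
apply/le_anti; rewrite term_le0 /= Sk oppr_ge0.
by apply: sumr_le0 => p _.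
Qed.

(** Row [k] of the equation for the marks writes [2 a_k + A_km a_m] as a sum of non-negative terms
    over the other nodes. A product of at least 4 forces both such numbers for [i] and [j] to
    vanish. Then no edge leaves the pair, although node 0 lies outside it. *)
Lemma cartan_pair_lt4 i j : i != j -> i != ord0 -> j != ord0 ->
  A i j * A j i <= 3.
Proof.
case: gcmA => A2 Aneg A0 ij i0 j0; case: marks => a_gt0 _ Aa0.
have rowE k m : k != m -> \sum_(p | (p != k) && (p != m)) - A k p * (a p)%:Z
    = 2 * (a k)%:Z + A k m * (a m)%:Z.
  move=> km; have := Aa0 k; rewrite (bigD1 k) //= (bigD1 m) 1?eq_sym //= A2.
  move=> /eqP; rewrite addrA addr_eq0 => /eqP ->.
  by rewrite -sumrN; apply: eq_bigr => p _; rewrite mulNr.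
have rowT k m p : k != m -> p != k -> 0 <= - A k p * (a p)%:Z.
  by move=> km pk; rewrite mulr_ge0 // oppr_ge0 Aneg // eq_sym.
have row_ge0 k m : k != m -> 0 <= 2 * (a k)%:Z + A k m * (a m)%:Z.
  move=> km; rewrite -rowE //; apply: sumr_ge0 => p /andP[pk _].
  exact: (rowT k m).
have row_eq0 k m p : k != m -> p != k -> p != m ->
    2 * (a k)%:Z + A k m * (a m)%:Z = 0 -> A k p = 0.
  move=> km pk pm; rewrite -rowE // => /eqP.
  rewrite psumr_eq0; last by move=> z /andP[zk _]; apply: (rowT k m).
  move=> /allP /(_ p (mem_index_enum _)); rewrite pk pm /= mulf_eq0 oppr_eq0.
  by have := a_gt0 p; case: (a p) => // ? _ /orP[/eqP //|].
have ji : j != i by rewrite eq_sym.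
have p0 := Aneg _ _ ij; have q0 := Aneg _ _ ji.
have ai := a_gt0 i; have aj := a_gt0 j.
have ri := row_ge0 _ _ ij; have rj := row_ge0 _ _ ji.
rewrite leNgt; apply/negP => pq.
have [ei ej] : 2 * (a i)%:Z + A i j * (a j)%:Z = 0 /\
               2 * (a j)%:Z + A j i * (a i)%:Z = 0.
  by split; nia.
have [||k [m [/[!inE] kJ mJ /eqP]]] := @indA [set i; j].
- by exists i; rewrite !inE eqxx.
- by exists ord0; rewrite !inE ![ord0 == _]eq_sym negb_or i0.
move: mJ; rewrite negb_or => /andP[mi mj]; apply.
by case/orP: kJ => /eqP ->; [apply: (row_eq0 i j)|apply: (row_eq0 j i)].
Qed.

End Cartan.

(** * Mozes' numbers game: an orbit of the finite group has at most one dominant vector *)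

Section NumbersGame.
Variables (R : realType) (n : nat) (A : 'M[int]_n.+1) (a : 'I_n.+1 -> nat).
Hypotheses (gcmA : gcm A) (indA : indecomposable A) (marks : null_marks A a).
Local Notation crt i := (simple_coroot R A (lift ord0 i)).
Local Notation rt i := (simple_root R (lift ord0 i)).
Local Notation sr i := (srefl R A (lift ord0 i)).

Definition dominant (y : 'rV[R]_n.+1) : Prop :=
  forall i : 'I_n, 0 <= pairing (crt i) y.

(** Plays of the numbers game: a move reflects at a negative coordinate, which adds a positive
    multiple of a simple root. *)
Inductive ascends : 'rV[R]_n.+1 -> 'rV[R]_n.+1 -> Prop :=
| ascends_refl y : ascends y y
| ascends_step y i z :
    pairing (crt i) y < 0 -> ascends (y *m sr i) z -> ascends y z.

Lemma pairing_srefl (y : 'rV[R]_n.+1) (i : 'I_n) :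
  pairing (crt i) (y *m sr i) = - pairing (crt i) y.
Proof.
by rewrite mul_reflection pairingBr pairingZr pairing_simple2 //; lra.
Qed.

Lemma ascends_inv y z : ascends y z ->
  z = y \/ exists2 i, pairing (crt i) y < 0 & ascends (y *m sr i) z.
Proof. by case=> [t|t i u lt0 asc]; [left | right; exists i]. Qed.

Lemma ascends_dominant y z : dominant y -> ascends y z -> z = y.
Proof. by move=> dom /ascends_inv[-> // | [k]]; rewrite ltNge dom. Qed.

(** Moves at [i] and [j] stay in the plane through [y] spanned by two simple roots. In the
    coordinates [u], [v] of that plane a move is an affine formula, so a whole play is checked by
    linear arithmetic. *)
Lemma ascends_rank2 y i j u v u' z : i != j ->
  let Fi := pairing (crt i) y in
  let Aij := (A (lift ord0 i) (lift ord0 j))%:~R in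
  Fi + 2 * u + Aij * v < 0 -> u' = - Fi - u - Aij * v ->
  ascends (y + u' *: rt i + v *: rt j) z ->
  ascends (y + u *: rt i + v *: rt j) z.
Proof.
move=> ij /= Flt0 -> asc.
have Fi : pairing (crt i) (y + u *: rt i + v *: rt j) =
    pairing (crt i) y + 2 * u + (A (lift ord0 i) (lift ord0 j))%:~R * v.
  rewrite !pairingDr !pairingZr pairing_simple2 // pairing_simple.
  by rewrite (mulrC u) (mulrC v).
apply: (ascends_step (i := i)); first by rewrite Fi.
rewrite mul_reflection Fi; congr (ascends _ z): asc.
apply/rowP => k; rewrite !mxE; ring.
Qed.

Lemma ascends_rank2r y i j u v v' z : i != j ->
  let Fj := pairing (crt j) y in
  let Aji := (A (lift ord0 j) (lift ord0 i))%:~R in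
  Fj + 2 * v + Aji * u < 0 -> v' = - Fj - v - Aji * u ->
  ascends (y + u *: rt i + v' *: rt j) z ->
  ascends (y + u *: rt i + v *: rt j) z.
Proof.
move=> ij; rewrite ![_ + u *: _ + _]addrAC; apply: ascends_rank2.
by rewrite eq_sym.
Qed.

(* Both chains of reflections end at the image of [y] under the longest element
   of the dihedral group of [i] and [j]. *)
Lemma ascends_confluent y i j : i != j ->
  pairing (crt i) y < 0 -> pairing (crt j) y < 0 ->
  exists z, ascends (y *m sr i) z /\ ascends (y *m sr j) z.
Proof.
move=> ij Fi Fj.
have lij : lift ord0 i != lift ord0 j by rewrite (inj_eq lift_inj).
(* The rank 2 types A1 x A1, A2, B2 and G2, the last two in both orientations. *)
have [p [q [Ap Aq pq]]] : exists p q : nat,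
    [/\ A (lift ord0 i) (lift ord0 j) = - p%:Z,
        A (lift ord0 j) (lift ord0 i) = - q%:Z &
        [|| (p == 0) && (q == 0), (p == 1) && (q == 1),
            (p == 1) && (q == 2), (p == 2) && (q == 1),
            (p == 1) && (q == 3) | (p == 3) && (q == 1)]%N].
  have := cartan_pair_lt4 gcmA indA marks lij isT isT.
  have [_ Aneg A0] := gcmA.
  have := Aneg _ _ lij; have := Aneg (lift ord0 j) (lift ord0 i).
  rewrite eq_sym => /(_ lij); have := A0 (lift ord0 i) (lift ord0 j).
  have := A0 (lift ord0 j) (lift ord0 i).
  move: (A (lift ord0 i) (lift ord0 j)) (A (lift ord0 j) (lift ord0 i)).
  move=> P Q QP PQ Q0 P0 lt4; exists `|P|%N, `|Q|%N; split; lia.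
have -> : y *m sr i = y + - pairing (crt i) y *: rt i + 0 *: rt j.
  by rewrite mul_reflection scaleNr scale0r addr0.
have -> : y *m sr j = y + 0 *: rt i + - pairing (crt j) y *: rt j.
  by rewrite mul_reflection scaleNr scale0r addr0.
have stepi := @ascends_rank2 y i j; have stepj := @ascends_rank2r y i j.
rewrite /= Ap Aq in stepi stepj.
have fin u v u' v' : u = u' -> v = v' ->
  ascends (y + u *: rt i + v *: rt j) (y + u' *: rt i + v' *: rt j).
  by move=> -> ->; apply: ascends_refl.
Ltac go step := eapply step => //; first lra.
(* After its first move each play makes 1, 2, 3 or 5 more moves, according to the type. The first
   play of each pair determines the meeting point, and the second is shown to reach the same
   coordinates. *)
case/or4P: pq => [||| /or3P[]] /andP[/eqP Ep /eqP Eq]; subst p q;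
  eexists; split.
- go stepj; apply: ascends_refl.
- go stepi; apply: fin; lra.
- go stepj; go stepi; apply: ascends_refl.
- go stepi; go stepj; apply: fin; lra.
- go stepj; go stepi; go stepj; apply: ascends_refl.
- go stepi; go stepj; go stepi; apply: fin; lra.
- go stepj; go stepi; go stepj; apply: ascends_refl.
- go stepi; go stepj; go stepi; apply: fin; lra.
- go stepj; go stepi; go stepj; go stepi; go stepj; apply: ascends_refl.
- go stepi; go stepj; go stepi; go stepj; go stepi; apply: fin; lra.
- go stepj; go stepi; go stepj; go stepi; go stepj; apply: ascends_refl.
- go stepi; go stepj; go stepi; go stepj; go stepi; apply: fin; lra.
Qed.

Variables (W0 : finGroupType) (r : W0 -> 'M[R]_n.+1).
Hypothesis HW : finite_weyl_group A a r.

Lemma r_inj : injective r. Proof. by case: HW. Qed.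

Lemma rM u v : r (u * v)%g = r u *m r v. Proof. by case: HW. Qed.

Lemma r1 : r 1%g = 1%:M.
Proof.
have [_ _ rgr _ _] := HW.
have [u _ ru] : range r 1%:M by rewrite rgr; exists [::]; rewrite big_nil.
by rewrite -ru; congr r; apply: (mulgI u); apply: r_inj;
  rewrite mulg1 rM ru mul1mx.
Qed.

Lemma cl_unique g u : eq_on_h0 a (r u) g -> cl a r g = u.
Proof.
have [_ _ rgr eq_par _] := HW; move=> ug; apply: xget_unique => //= v vg.
by apply/r_inj/eq_par; rewrite -?rgr;
  [exists v | exists u | move=> x x0; rewrite vg ?ug].
Qed.

Definition refl (i : 'I_n) : W0 := cl a r (sr i).

Lemma r_refl i : r (refl i) = sr i.
Proof.
have [_ _ rgr _ _] := HW.
have [u _ ru] : range r (sr i) by rewrite rgr; exists [:: i]; rewrite big_seq1.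
by rewrite /refl (@cl_unique _ u) ?ru.
Qed.

Lemma refl_invol i : (refl i * refl i)%g = 1%g.
Proof. by apply: r_inj; rewrite rM !r_refl srefl_invol // r1. Qed.

Lemma cl_srefl i : eq_on_h0 a (r (cl a r (srefl R A i))) (srefl R A i).
Proof.
have [_ _ rgr _ cl_ex] := HW.
have [|h h_par ih] := cl_ex (srefl R A i).
  by exists [:: i]; rewrite big_seq1.
have [u _ ru] : range r h by rewrite rgr.
by rewrite (@cl_unique _ u) ru => x x0; rewrite ih.
Qed.

Lemma W0_ind (P : W0 -> Prop) :
  P 1%g -> (forall w i, P w -> P (w * refl i)%g) -> forall w, P w.
Proof.
move=> P1 PM w; have [_ _ rgr _ _] := HW.
have [s rw] : parabolic A (r w) by rewrite -rgr; exists w.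
elim/last_ind: s w rw => [|s i IH] w rw.
  by rewrite (_ : w = 1%g) //; apply: r_inj; rewrite r1 rw big_nil.
rewrite -[w]mulg1 -(refl_invol i) mulgA; apply: PM; apply: IH.
rewrite rM r_refl rw -cats1 big_cat big_seq1 /=.
by apply: etrans (esym (mulmxA _ _ _)) _; rewrite srefl_invol // mulmx1.
Qed.

Variable y0 : 'rV[R]_n.+1.
(** A termination measure. A move raises [pot], the sum of the coordinates on the simple roots,
    hence shrinks the set [above], which is finite as a set of group elements. *)
Let pot (y : 'rV[R]_n.+1) : R := pairing (const_mx 1) y.
Let above w := [set v | pot (y0 *m r w) < pot (y0 *m r v)]%SET.

Let srefl_orbit w i : y0 *m r w *m sr i = y0 *m r (w * refl i)%g.
Proof. by rewrite rM r_refl mulmxA. Qed.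

Let above_lt w i : pairing (crt i) (y0 *m r w) < 0 ->
  (#|above (w * refl i)%g| < #|above w|)%N.
Proof.
move=> lt0.
have ltp : pot (y0 *m r w) < pot (y0 *m r (w * refl i)%g).
  rewrite -srefl_orbit mul_reflection /pot pairingBr pairingZr.
  by rewrite pairing_simple_root mxE; lra.
apply: proper_card; apply/properP; split.
  by apply/fintype.subsetP => v; rewrite !inE; apply: lt_trans.
by exists (w * refl i)%g; rewrite !inE // ltxx.
Qed.

Let ascends_orbit w z : ascends (y0 *m r w) z -> exists v, z = y0 *m r v.
Proof.
move=> asc; have [v Ev] : exists v, y0 *m r w = y0 *m r v by exists w.
move: asc v Ev; move: (y0 *m r w) => y asc.
elim: asc => {y z} [y|y i z _ _ IH] v Ev; first by exists v.
by apply: (IH (v * refl i)%g); rewrite Ev srefl_orbit.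
Qed.

Lemma ascends_to_dominant w : exists2 d, dominant d & ascends (y0 *m r w) d.
Proof.
have [k le_k] := ubnP #|above w|; elim: k => // k IH in w le_k *.
have [dom|/existsNP[i /negP]] := pselect (dominant (y0 *m r w)).
  by exists (y0 *m r w) => //; apply: ascends_refl.
rewrite -ltNge => lt0.
have [|d dom asc] := IH (w * refl i)%g; first exact: leq_trans (above_lt lt0) _.
by exists d => //; apply: (ascends_step lt0); rewrite srefl_orbit.
Qed.

Lemma ascends_trans x y z : ascends x y -> ascends y z -> ascends x z.
Proof.
move=> asc yz; elim: asc yz => // t i v lt0 _ IH /IH.
exact: ascends_step.
Qed.

(* Newman's lemma *)
Lemma ascends_dominant_unique w d d' : dominant d -> dominant d' ->
  ascends (y0 *m r w) d -> ascends (y0 *m r w) d' -> d = d'.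
Proof.
move=> dom dom'.
have [k le_k] := ubnP #|above w|; elim: k => // k IH in w d d' dom dom' le_k *.
move=> /ascends_inv[Ed /ascends_dominant -> // | [i lti asc]].
  by rewrite -Ed.
move=> /ascends_inv[Ed' | [j ltj asc']].
  by have := dom' i; rewrite Ed' leNgt lti.
have lek m : pairing (crt m) (y0 *m r w) < 0 -> (#|above (w * refl m)%g| < k)%N.
  by move=> lt0; apply: leq_trans (above_lt lt0) _.
rewrite srefl_orbit in asc; rewrite srefl_orbit in asc'.
have [Eij|ij] := eqVneq i j.
  by rewrite -Eij in asc'; apply: IH asc asc'; rewrite // lek.
have [z] := ascends_confluent ij lti ltj.
rewrite !srefl_orbit => -[iz jz].
have [v Ez] := ascends_orbit iz.
(* A dominant end [d0] of a play from the meeting point [z] is reached through both first moves, so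
   by induction it equals [d] and [d']. *)
have [d0 dom0] := ascends_to_dominant v; rewrite -Ez => asc0.
transitivity d0.
  by apply: IH (dom) dom0 (lek _ lti) asc _; apply: ascends_trans asc0.
apply: IH dom0 (dom') (lek _ ltj) _ asc'; exact: ascends_trans asc0.
Qed.

Lemma dominant_orbit_unique w : dominant y0 -> dominant (y0 *m r w) ->
  y0 *m r w = y0.
Proof.
move=> dom0 domw.
(* Allowing a further play up to [d] makes induction on [w] possible, since the intermediate vectors
   need not be dominant. *)
suff main d : dominant d -> ascends (y0 *m r w) d -> d = y0.
  by apply: main => //; apply: ascends_refl.
move=> dom {domw}.
elim/W0_ind: w d dom => [|w i IH] d dom.
  by rewrite r1 mulmx1 => /(ascends_dominant dom0).
rewrite -srefl_orbit => asc.
(* The vectors of [w] and [w * refl i] are joined by a move in one direction or the other, or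
   coincide. When the move goes from the latter to the former, uniqueness of the dominant end
   transfers the conclusion. *)
have [lt0|gt0|eq0] := ltgtP (pairing (crt i) (y0 *m r w)) 0.
- by apply: IH => //; apply: ascends_step asc.
- have [d0 dom0' asc0] := ascends_to_dominant w.
  rewrite -(IH _ dom0' asc0); rewrite srefl_orbit in asc.
  apply: (ascends_dominant_unique dom dom0' asc).
  rewrite -srefl_orbit; apply: (@ascends_step _ i).
    by rewrite pairing_srefl; lra.
  by rewrite -mulmxA srefl_invol // mulmx1.
- by apply: IH => //; rewrite mul_reflection eq0 scale0r subr0 in asc.
Qed.

End NumbersGame.

(** * Triviality of stabilizers, and the twisted action on the coroot lattice *)

Section TwistedCorootAction.
Variables (R : realType) (n : nat) (A : 'M[int]_n.+1) (a : 'I_n.+1 -> nat).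
Hypotheses (gcmA : gcm A) (indA : indecomposable A) (marks : null_marks A a).
Variables (W0 : finGroupType) (r : W0 -> 'M[R]_n.+1).
Hypothesis HW : finite_weyl_group A a r.
Local Notation crt i := (simple_coroot R A (lift ord0 i)).
Local Notation rt i := (simple_root R (lift ord0 i)).
Local Notation sr i := (srefl R A (lift ord0 i)).
Local Notation delta := (delta R a).

Lemma large_multiple (p b : 'I_n -> R) : (forall i, 0 < p i) ->
  exists2 K, 0 <= K & forall i, 0 <= K * p i + b i.
Proof.
move=> p_gt0; exists (\sum_j `|b j| / p j) => [|i].
  by apply: sumr_ge0 => j _; rewrite divr_ge0 // ltW.
have : `|b i| / p i <= \sum_j `|b j| / p j.
  rewrite (bigD1 i) //= lerDl; apply: sumr_ge0 => j _.
  by rewrite divr_ge0 // ltW.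
by rewrite ler_pdivrMr // => le_b;
  have := ler_norm (- b i); rewrite normrN; lra.
Qed.

(* Perturbing [y] to [K y + psi] turns the uniqueness of the dominant element of
   an orbit into the triviality of the stabilizer of [y]. *)
Lemma strictly_dominant_free y u : (forall i, 0 < pairing (crt i) y) ->
  (forall i, 0 < pairing (crt i) (y *m r u)) -> u = 1%g.
Proof.
move=> y_gt0 yu_gt0; apply: (r_inj HW); rewrite (r1 HW).
have fix_y z : dominant A z -> dominant A (z *m r u) -> z *m r u = z.
  exact: (dominant_orbit_unique gcmA indA marks HW).
have yu : y *m r u = y by apply: fix_y => i; apply: ltW.
suff fix_psi (psi : 'rV_n.+1) : psi *m r u = psi.
  by apply/row_matrixP => k; rewrite !rowE mulmx1 fix_psi.
have [K K0 Ky] := large_multiple (fun i => pairing (crt i) psi) y_gt0.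
have [L L0 Ly] := large_multiple (fun i => pairing (crt i) (psi *m r u)) yu_gt0.
(* [K] makes the perturbed vector dominant and [L] its image under [u]; as [u] fixes [y], the sum
   serves both purposes. *)
have := fix_y ((K + L) *: y + psi).
rewrite mulmxDl -scalemxAl yu => fixz; apply: (addrI ((K + L) *: y)).
apply: fixz => i; rewrite pairingDr pairingZr mulrDl.
  by have := Ky i; have := mulr_ge0 L0 (ltW (y_gt0 i)); lra.
by have := Ly i; have := mulr_ge0 K0 (ltW (y_gt0 i)); rewrite yu; lra.
Qed.

Lemma simple_coroot_free_lift (x : 'I_n -> R) :
  \sum_i x i *: crt i = 0 -> forall i, x i = 0.
Proof.
move=> sum0 i; pose x' j := if unlift ord0 j is Some k then x k else 0.
have := simple_coroot_free gcmA indA marks (x := x') _ _ (lift ord0 i).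
rewrite /x' liftK; apply; first by rewrite unlift_none.
rewrite big_ord_recl unlift_none scale0r add0r -[RHS]sum0.
by apply: eq_bigr => k _; rewrite liftK.
Qed.

Lemma delta_r w : delta *m r w = delta.
Proof.
elim/(W0_ind gcmA HW): w => [|w i IH]; first by rewrite (r1 HW) mulmx1.
rewrite (rM HW) mulmxA IH (r_refl HW) mul_reflection pairing_coroot_delta //.
by rewrite scale0r subr0.
Qed.

Lemma mem_root_pairs u i :
  (rt i *m r (u^-1)%g, r u *m crt i) \in root_pairs A r.
Proof.
rewrite mem_undup; apply/allpairsP; exists (u, i).
by rewrite !mem_enum; split.
Qed.

Lemma root_pairsP p : p \in root_pairs A r ->
  exists u i, p = (rt i *m r (u^-1)%g, r u *m crt i).
Proof. by rewrite mem_undup => /allpairsP[[u i] [_ _ ->]]; exists u, i. Qed.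

Lemma mem_pos_root_pairs i : (rt i, crt i) \in pos_root_pairs A r.
Proof.
rewrite mem_filter; apply/andP; split.
  by apply/forallP => j; rewrite mxE ler0n.
by have := mem_root_pairs 1%g i; rewrite invg1 (r1 HW) mulmx1 mul1mx.
Qed.

Lemma int_root u i : exists z : 'rV[int]_n.+1,
  z 0 ord0 = 0 /\ rt i *m r u = map_mx intr z.
Proof.
elim/(W0_ind gcmA HW): u => [|u j [z [z0 IH]]].
  exists (delta_mx 0 (lift ord0 i)); rewrite mxE (r1 HW) mulmx1; split=> //.
  by rewrite map_delta_mx.
exists (z - (\sum_k z 0 k * A (lift ord0 j) k) *: delta_mx 0 (lift ord0 j)).
rewrite !mxE z0 mulr0 subr0; split=> //.
rewrite (rM HW) mulmxA IH (r_refl HW) mul_reflection; apply/rowP => k.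
rewrite !mxE rmorphB rmorphM rmorph_sum /=; congr (_ - _ * _).
  by rewrite /pairing mxE; apply: eq_bigr => m _; rewrite !mxE rmorphM.
by rewrite rmorph_nat.
Qed.

Lemma root_coord0 u i : (rt i *m r u) 0 ord0 = 0.
Proof. by have [z [z0 ->]] := int_root u i; rewrite mxE z0. Qed.

Lemma weyl_groupM g h : weyl_group A g -> weyl_group A h ->
  weyl_group A (g *m h : 'M[R]_n.+1).
Proof. by move=> [s ->] [t ->]; exists (s ++ t); rewrite big_cat. Qed.

Lemma inv_mx1 (g h : 'M[R]_n.+1) : g *m h = 1%:M -> g^-1 = h.
Proof.
move=> gh; have gU : g \is a GRing.unit by have [] := mulmx1_unit gh.
by apply: (mulrI gU); rewrite divrr // -[RHS]gh.
Qed.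

Lemma weyl_groupV g : weyl_group A g -> weyl_group A (g^-1 : 'M[R]_n.+1).
Proof.
move=> [s]; elim: s g => [|i s IH] g ->.
  by rewrite big_nil invr1; exists [::]; rewrite big_nil.
have sU j : srefl R A j \is a GRing.unit.
  by have [] := mulmx1_unit (srefl_invol R gcmA j).
have PU (t : seq 'I_n.+1) : \prod_(j <- t) srefl R A j \is a GRing.unit.
  by elim: t => [|j t PU]; rewrite ?big_nil ?unitr1 // big_cons unitrMr.
rewrite big_cons invrM // (inv_mx1 (srefl_invol R gcmA i)).
apply: weyl_groupM; first exact: IH.
by exists [:: i]; rewrite big_seq1.
Qed.

Lemma weyl_group_srefl i : weyl_group A (srefl R A i).
Proof. by exists [:: i]; rewrite big_seq1. Qed.

(** The hypothesis says that reflecting [c_i alpha_i^vee] at [k] subtracts an integer multiple of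
    [c_k alpha_k^vee], so the lattice spanned by these vectors is stable. *)
Lemma c_vec_stable (c : 'rV[R]_n.+1 -> rat) :
  (forall i k, exists K : int,
     ratr (c (rt i)) * (A (lift ord0 i) (lift ord0 k))%:~R
       = ratr (c (rt k)) * K%:~R :> R) ->
  forall w lam, exists mu, r w *m c_vec A c lam = c_vec A c mu.
Proof.
move=> c_int w.
elim/(W0_ind gcmA HW): w => [|w k IH] lam.
  by exists lam; rewrite (r1 HW) mul1mx.
suff [mu Emu] : exists mu, sr k *m c_vec A c lam = c_vec A c mu.
  by rewrite (rM HW) (r_refl HW) -mulmxA Emu.
have [K EK] := choice (fun i => c_int i k).
pose m := \sum_i lam 0 i * K i; exists (lam - m *: delta_mx 0 k).
have -> : c_vec A c (lam - m *: delta_mx 0 k) =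
    c_vec A c lam - (ratr (c (rt k)) * m%:~R) *: crt k.
  clearbody m; rewrite /c_vec [X in _ = _ - X](_ : _ =
    \sum_i ((i == k)%:R * (ratr (c (rt k)) * m%:~R)) *: crt i).
    rewrite -sumrB; apply: eq_bigr => i _; rewrite -scalerBl !mxE /=.
    congr (_ *: _); rewrite intrB intrM; case: eqVneq => [->|_] /=; ring.
  rewrite (bigD1 k) //= eqxx mul1r big1 ?addr0 // => i /negPf ->.
  by rewrite mul0r scale0r.
rewrite reflection_mul; congr (_ - _ *: _).
rewrite pairing_suml rmorph_sum mulr_sumr; apply: eq_bigr => i _.
by rewrite pairingZl pairing_simple /= intrM mulrAC EK; ring.
Qed.

Variable c : 'rV[R]_n.+1 -> rat.
Hypothesis HS : reflection_spacing A a r c.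

Lemma c_gt0 i : (0 : R) < ratr (c (rt i)).
Proof. by rewrite ltr0q; case: HS => + _ => /(_ _ (mem_pos_root_pairs i)). Qed.

Lemma transl_inv x : pairing x delta = 0 ->
  (1 + x *m delta)^-1 = 1 - x *m delta.
Proof.
move=> x0; apply: inv_mx1; rewrite mulmxBr mulmx1 mulmxDl mul1mx -mulmxA.
rewrite (mulmxA delta) [delta *m x]mx11_scalar -/(pairing x delta) x0.
by rewrite mul_scalar_mx scale0r mulmx0 addr0 addrK.
Qed.

(** This translation is the product of the reflections in two neighbouring parallel hyperplanes,
    those of [alpha_i - c_i delta] and of [alpha_i]. *)
Lemma translation_weyl i :
  weyl_group A (1 + (ratr (c (rt i)) *: crt i) *m delta).
Proof.
have [_ HSiff] := HS.
have := HSiff (reflection (crt i) (rt i - (ratr (c (rt i)) * 1%:~R) *: delta)).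
case=> _ [|w [j [wW Eg]]].
  by exists (rt i, crt i), 1; split=> //; apply: mem_pos_root_pairs.
have gW : weyl_group A (w * srefl R A j * w^-1).
  apply: weyl_groupM; last exact: weyl_groupV.
  exact: weyl_groupM (weyl_group_srefl _).
move: gW; rewrite -Eg => /weyl_groupM/(_ (weyl_group_srefl (lift ord0 i))).
congr (weyl_group A _); rewrite {1}/reflection mulmxBl mul1mx -mulmxA.
have -> : (rt i - (ratr (c (rt i)) * 1%:~R) *: delta) *m sr i
          = - rt i - ratr (c (rt i)) *: delta.
  rewrite mul_reflection pairingBr pairingZr pairing_coroot_delta //.
  by rewrite pairing_simple2 //; apply/rowP => k; rewrite !mxE; ring.
rewrite mulmxBr mulmxN opprB opprK /srefl /reflection [X in _ + X]addrC.
by rewrite addrA subrK -scalemxAr -scalemxAl.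
Qed.

Lemma conj_translation x k : pairing x delta = 0 ->
  (1 + x *m delta) * sr k * (1 + x *m delta)^-1
    = reflection (crt k) (rt k - pairing x (rt k) *: delta).
Proof.
move=> x0; rewrite transl_inv //.
have trow (y : 'rV_n.+1) : y *m (1 - x *m delta) = y - pairing x y *: delta.
  by rewrite mulmxBr mulmx1 mulmxA [y *m x]mx11_scalar mul_scalar_mx.
have tcol : (1 + x *m delta) *m crt k = crt k.
  rewrite mulmxDl mul1mx -mulmxA [delta *m _]mx11_scalar -/(pairing _ _).
  by rewrite pairing_coroot_delta // mul_mx_scalar scale0r addr0.
have tt : (1 + x *m delta) *m (1 - x *m delta) = 1%:M.
  have := trow (delta *m 1%:M).
  rewrite mulmxDl mul1mx -mulmxA mulmx1 x0 scale0r subr0 => ->.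
  by rewrite subrK.
rewrite /srefl /reflection -trow.
move: (1 - x *m delta) tt => t' tt; rewrite mulrBr mulr1 mulrBl [X in X - _]tt.
congr (_ - _).
transitivity ((1 + x *m delta) *m (crt k *m rt k) *m t'); first by [].
by rewrite [in LHS]mulmxA tcol mulmxA.
Qed.

(** A reflection determines its linear form up to a factor [t]. Coordinate 0, which vanishes on
    finite roots but not on [delta], separates the two parts of the form. Integrality of root
    coordinates makes [t] and its inverse integers, and positivity of [p.1] leaves [t = 1]. *)
Lemma pos_root_reflection p k (d e : R) : p \in pos_root_pairs A r ->
  reflection (crt k) (rt k - d *: delta) = reflection p.2 (p.1 - e *: delta) ->
  p.1 = rt k /\ d = e.
Proof.
rewrite mem_filter => /andP[/forallP pos /root_pairsP[u [m Ep]]] Erefl.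
have Emx : crt k *m (rt k - d *: delta) = p.2 *m (p.1 - e *: delta).
  by apply: (can_inj (subKr 1)).
pose t := pairing p.2 (rt k) / 2.
have Erow : rt k - d *: delta = t *: (p.1 - e *: delta).
  have := congr1 (mulmx (rt k)) Emx; rewrite !mulmxA.
  rewrite [rt k *m crt k]mx11_scalar [rt k *m p.2]mx11_scalar.
  rewrite -/(pairing _ _) -/(pairing _ _) pairing_simple2 // !mul_scalar_mx.
  by move=> E2; rewrite /t mulrC -scalerA -E2 scalerA mulVf ?scale1r ?pnatr_eq0.
have a0 : (a ord0)%:R != 0 :> R.
  by case: marks => a_gt0 _ _; rewrite pnatr_eq0 -lt0n.
have Ed : d = t * e.
  have := congr1 (fun y : 'rV_n.+1 => y 0 ord0) Erow.
  have p0 : p.1 0 ord0 = 0 by rewrite Ep root_coord0.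
  rewrite !mxE p0 /= !sub0r mulrN => /oppr_inj; rewrite mulrA.
  exact: mulIf.
have Ert : rt k = t *: p.1.
  by move: Erow; rewrite scalerBr scalerA -Ed => /addIr.
have [z [_ Ez]] := int_root (u^-1)%g m; have [z' [_ Ez']] := int_root u k.
have tz : t * (z 0 (lift ord0 k))%:~R = 1.
  have := congr1 (fun y : 'rV_n.+1 => y 0 (lift ord0 k)) Ert.
  by rewrite Ep /= Ez !mxE !eqxx.
have tz' : t = (z' 0 (lift ord0 m))%:~R.
  have := congr1 (fun y : 'rV_n.+1 => (y *m r u) 0 (lift ord0 m)) Ert.
  rewrite Ez' Ep /= -scalemxAl -mulmxA -(rM HW) mulVg (r1 HW) mulmx1 !mxE.
  by rewrite !eqxx mulr1.
have z_ge0 : 0 <= (z 0 (lift ord0 k))%:~R :> R.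
  by have := pos (lift ord0 k); rewrite Ep /= Ez mxE.
have zz' : z' 0 (lift ord0 m) * z 0 (lift ord0 k) = 1.
  by apply: (@intr_inj R); rewrite intrM -tz' tz.
have t1 : t = 1.
  rewrite ler0z in z_ge0; suff -> : t = 1%:Z%:~R by [].
  rewrite tz'; congr _%:~R; move: zz' z_ge0; clear.
  move: (z' 0 _) (z 0 _) => x' x xx' x_ge0.
  have /eqP := congr1 absz xx'; rewrite abszM muln_eq1 => /andP[_ /eqP x1].
  have x1' : x = 1 by lia.
  by move: xx'; rewrite x1' mulr1.
by split; [rewrite Ert t1 scale1r | rewrite Ed t1 mul1r].
Qed.

(** Conjugating [s_k] by the translation by [c_i alpha_i^vee] gives a reflection of the affine group
    whose hyperplane is shifted by [c_i A_ik]. The spacing in direction [alpha_k] makes this shift a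
    multiple of [c_k]. *)
Lemma twisted_cartan_int i k : exists K : int,
  ratr (c (rt i)) * (A (lift ord0 i) (lift ord0 k))%:~R
    = ratr (c (rt k)) * K%:~R :> R.
Proof.
have ci0 : pairing (ratr (c (rt i)) *: crt i) delta = 0.
  by rewrite pairingZl pairing_coroot_delta // mulr0.
have [_ HSiff] := HS.
set d := pairing (ratr (c (rt i)) *: crt i) (rt k).
have [+ _] := HSiff (reflection (crt k) (rt k - d *: delta)).
case=> [|p [K [p_pos]]].
  exists (1 + (ratr (c (rt i)) *: crt i) *m delta), (lift ord0 k); split.
    exact: translation_weyl.
  by rewrite conj_translation.
move=> /(pos_root_reflection p_pos)[Ep].
by rewrite /d pairingZl pairing_simple Ep => ->; exists K.
Qed.

Local Notation cvec lam := (c_vec A c lam).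

Lemma c_vec_inj : injective (c_vec A c).
Proof.
move=> lam mu /eqP; rewrite -subr_eq0 -sumrB => /eqP E; apply/rowP => i.
have := simple_coroot_free_lift (x := fun i =>
  ratr (c (rt i)) * (lam 0 i)%:~R - ratr (c (rt i)) * (mu 0 i)%:~R).
move=> /(_ _ i) /=; rewrite -mulrBr => H.
have /eqP : ratr (c (rt i)) * ((lam 0 i)%:~R - (mu 0 i)%:~R) = 0 :> R.
  by apply: H; rewrite -[RHS]E; apply: eq_bigr => j _; rewrite scalerBl.
rewrite mulf_eq0 (gt_eqF (c_gt0 i)) /= subr_eq0 eqr_int.
by move/eqP.
Qed.

Lemma mul_delta_inj (u v : 'cV[R]_n.+1) : u *m delta = v *m delta -> u = v.
Proof.
have [a_gt0 _ _] := marks; move=> E; apply/colP => i.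
have := congr1 (fun M : 'M_n.+1 => M i ord0) E.
rewrite !mxE !big_ord1 mxE => /mulIf -> //.
by rewrite pnatr_eq0 -lt0n.
Qed.

Lemma coroot_actP w lam : cvec (coroot_act A a r c w lam) = r w *m cvec lam.
Proof.
rewrite /coroot_act; set P := (X in xget _ X).
have conj : r w * translation A a c lam * (r w)^-1
    = 1 + (r w *m cvec lam) *m delta.
  have rwU : r w \is a GRing.unit.
    by have [] := mulmx1_unit (_ : r w *m r w^-1%g = 1%:M);
      rewrite // -(rM HW) mulgV (r1 HW).
  apply: (mulIr rwU); rewrite mulrVK // mulrDr mulr1 mulrDl mul1r.
  congr (_ + _); rewrite -[RHS]mulmxA delta_r.
  exact: mulmxA.
(* A witness exists, so [xget] does not fall back on its default value 0. *)
have [mu Emu] := c_vec_stable twisted_cartan_int w lam.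
have Pmu : P mu by rewrite /P /= conj Emu.
have: P (xget 0 P) by apply: xgetI Pmu.
move: (xget 0 P) => nu; rewrite {1}/P /= conj /translation => /addrI E.
exact/esym/mul_delta_inj.
Qed.

End TwistedCorootAction.

(** * Distinctness of the characters *)

Section Characters.
Variables (R : realType) (n : nat) (A : 'M[int]_n.+1) (a : 'I_n.+1 -> nat).
Hypotheses (gcmA : gcm A) (indA : indecomposable A) (marks : null_marks A a).
Variables (W0 : finGroupType) (r : W0 -> 'M[R]_n.+1).
Hypothesis HW : finite_weyl_group A a r.
Variable c : 'rV[R]_n.+1 -> rat.
Hypothesis HS : reflection_spacing A a r c.
Local Notation crt i := (simple_coroot R A (lift ord0 i)).
Local Notation rt i := (simple_root R (lift ord0 i)).
Local Notation refl := (refl A a r).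
Local Notation act := (coroot_act A a r c).
Local Notation e j := (delta_mx 0 j : 'rV[int]_n).

Lemma c_vec_delta j : c_vec A c (e j) = ratr (c (rt j)) *: crt j.
Proof.
rewrite /c_vec (bigD1 j) //= mxE !eqxx mulr1 big1 ?addr0 // => i /negPf ij.
by rewrite mxE ij mulr0 scale0r.
Qed.

Lemma coroot_vec_stable w i : exists b, r w *m crt i = coroot_vec R A b.
Proof.
have vecE lam : c_vec A (fun=> 1) lam = coroot_vec R A lam.
  by apply: eq_bigr => k _; rewrite rmorph1 mul1r.
have [|b Eb] := c_vec_stable gcmA HW (c := fun=> 1) _ w (e i).
  by move=> k m; exists (A (lift ord0 k) (lift ord0 m)); rewrite rmorph1.
exists b; rewrite -vecE -Eb vecE /coroot_vec (bigD1 i) //= mxE !eqxx scale1r.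
by rewrite big1 ?addr0 // => k /negPf ik; rewrite mxE ik scale0r.
Qed.

Variable theta : 'rV[int]_n.
Hypothesis theta_max : highest_coroot A r theta.

Lemma coroot_coord_le w i b : r w *m crt i = coroot_vec R A b ->
  forall k, `|b 0 k| <= theta 0 k.
Proof.
move=> Eb k; have [_ max] := theta_max; rewrite ler_norml lerNl.
apply/andP; split; last first.
  apply: max; exists (rt i *m r (w^-1)%g, r w *m crt i) => //.
  exact: mem_root_pairs.
(* For the lower bound, the opposite of a coroot is again a coroot, obtained from [w * refl i]. *)
have -> : - b 0 k = (- b) 0 k by rewrite mxE.
apply: max; exists (rt i *m r ((w * refl i)^-1)%g, r (w * refl i)%g *m crt i).
  exact: mem_root_pairs.
rewrite /= (rM HW) (r_refl HW) -mulmxA reflection_mul pairing_simple2 //.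
rewrite scaler_nat mulr2n opprD addrA subrr sub0r mulmxN Eb -sumrN.
by apply: eq_bigr => m _; rewrite mxE intrN scaleNr.
Qed.

Lemma ht_act_le w j : (forall i, c (rt j) <= c (rt i)) ->
  `|ht (act w (e j))| <= ht theta.
Proof.
move=> jmin; have [b Eb] := coroot_vec_stable w j.
apply: le_trans (ler_norm_sum _ _ _) _; apply: ler_sum => i _.
apply: le_trans (coroot_coord_le Eb i).
have := coroot_actP gcmA marks HW HS w (e j).
rewrite c_vec_delta -scalemxAr Eb => E.
have {E} Ei : ratr (c (rt i)) * (act w (e j) 0 i)%:~R
    = ratr (c (rt j)) * (b 0 i)%:~R :> R.
  apply/eqP; rewrite -subr_eq0; apply/eqP.
  apply: (simple_coroot_free_lift gcmA indA marks (x := fun i =>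
    ratr (c (rt i)) * (act w (e j) 0 i)%:~R - ratr (c (rt j)) * (b 0 i)%:~R)).
  under eq_bigr => k _ do
    rewrite scalerBl -(scalerA (ratr (c (rt j)))).
  by rewrite sumrB -scaler_sumr -[X in X - _]/(c_vec A c _) E subrr.
have ci := c_gt0 HW HS i; have cj := c_gt0 HW HS j.
have := congr1 (fun x : R => `|x|) Ei; rewrite /= 2![`|ratr _ * _|]normrM.
rewrite (gtr0_norm ci) (gtr0_norm cj) => Eabs.
rewrite -(ler_int R) !intr_norm -(ler_pM2l ci) Eabs ler_wpM2r //.
by rewrite ler_rat.
Qed.

(** If the orbit of [alpha_k^vee] is orthogonal to [y] and [A_km] is non-zero, reflecting
    [alpha_k^vee] at [m] shows the same for [alpha_m^vee]. Indecomposability then reaches every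
    node, including 0, which acts through [cl] because coroots lie in [h^0]. *)
Lemma orbit_span y j : (forall v, pairing (r v *m simple_coroot R A j) y = 0) ->
  forall i v, pairing (r v *m simple_coroot R A i) y = 0.
Proof.
pose orth i := `[< forall v, pairing (r v *m simple_coroot R A i) y = 0 >].
move=> /asboolP/= j0 i; apply/asboolP; rewrite -/(orth i).
apply/negPn/negP => i0.
have [||k [m [kJ /negP + /eqP Akm]]] := @indA [set i | orth i]%SET.
- by exists j; rewrite inE.
- by exists i; rewrite inE.
rewrite inE in kJ; apply; rewrite inE; apply/asboolP => v.
have := asboolW kJ (v * cl a r (srefl R A m))%g.
rewrite (rM HW) -mulmxA (cl_srefl HW) ?pairing_coroot_delta // reflection_mul.
rewrite mulmxBr -scalemxAr pairingBl pairingZl pairing_simple.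
rewrite (asboolW kJ) sub0r.
by move=> /eqP; rewrite oppr_eq0 mulf_eq0 intr_eq0 => /orP[/eqP|/eqP].
Qed.

Lemma exists_dual_row (f : 'I_n -> R) :
  exists y : 'rV[R]_n.+1, forall i, pairing (crt i) y = f i.
Proof.
pose B : 'M[R]_(n.+1, n) := \matrix_(j, i) crt i j 0.
have full : row_full B.
  rewrite /row_full -mxrank_tr -/(row_free _) -kermx_eq0.
  apply/eqP/row_matrixP => k; rewrite row0.
  have : row k (kermx B^T) *m B^T = 0 by rewrite -row_mul mulmx_ker row0.
  move: (row k _) => x xB; apply/rowP => i; rewrite [RHS]mxE.
  apply: (simple_coroot_free_lift gcmA indA marks (x := x 0)).
  apply/colP => m; have := congr1 (fun M : 'rV_n.+1 => M 0 m) xB.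
  rewrite summxE !mxE; apply: etrans; apply: eq_bigr => t _.
  by rewrite !mxE.
have /submxP[y Ey] := submx_full (\row_i f i) full.
exists y => i; have := congr1 (fun M : 'rV_n => M 0 i) Ey.
rewrite !mxE => ->; rewrite /pairing mxE; apply: eq_bigr => t _.
by rewrite !mxE.
Qed.

(** Two exponents in the interval from [-h] to [h] differ by at most [2 h], which is the source of
    the bound on the forbidden roots of unity. *)
Lemma root_of_unity_exprz_inj (F : fieldType) (q : F) (h x y : int) : q != 0 ->
  (forall k : nat, (1 <= k)%N -> k%:Z <= 2 * h -> q ^+ k != 1) ->
  `|x| <= h -> `|y| <= h -> q ^ x = q ^ y -> x = y.
Proof.
move=> q0 q_root; wlog le_xy : x y / x <= y.
  move=> W lex ley E; have [le|/ltW le] := leP x y; first exact: W.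
  by apply/esym/W.
move=> lex ley; have [k Ek] : exists k : nat, y = x + k%:Z.
  by exists `|y - x|%N; lia.
rewrite Ek expfzDr // -[LHS]mulr1 => /(mulfI (expfz_neq0 _ q0)) /esym qk.
case: k Ek qk => [|k] Ek qk; first by rewrite addr0.
rewrite -exprnP in qk; have le_k : k.+1%:Z <= 2 * h by lia.
by have := q_root k.+1 isT le_k; rewrite qk eqxx.
Qed.

Lemma coroot_act_characters_inj (F : fieldType) (q : F) w w' :
  (0 < n)%N -> q != 0 ->
  (forall k : nat, (1 <= k)%N -> k%:Z <= 2 * ht theta -> q ^+ k != 1) ->
  (forall lam, q ^ (- ht (act w lam)) = q ^ (- ht (act w' lam))) -> w = w'.
Proof.
move=> n_gt0 q0 q_root E; pose i0 := Ordinal n_gt0.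
have [j jmin] : exists j : 'I_n, forall i, c (rt j) <= c (rt i).
  have [j _ jmin] := @Order.TotalTheory.arg_minP _ _ _ i0 xpredT
    (fun i => c (rt i)) isT.
  by exists j => i; apply: jmin.
(* [phi] reads the height off [c(lam)]; its coordinates [1 / c_i] are positive, so it is strictly
   dominant. *)
have [phi phiE] := exists_dual_row (fun i => (ratr (c (rt i)))^-1).
have phi_c_vec lam : pairing (c_vec A c lam) phi = (ht lam)%:~R.
  rewrite pairing_suml /ht rmorph_sum; apply: eq_bigr => i _.
  by rewrite pairingZl phiE /= mulrAC divff ?mul1r // gt_eqF // (c_gt0 HW HS).
have actM u v lam : act u (act v lam) = act (u * v)%g lam.
  apply: (c_vec_inj gcmA indA marks HW HS).
  by rewrite !(coroot_actP gcmA marks HW HS) (rM HW) mulmxA.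
(* The characters are compared at every twisted conjugate of [alpha_j^vee], where all the heights
   stay within the bound. *)
have ht_eq v : ht (act (w * v)%g (e j)) = ht (act (w' * v)%g (e j)).
  apply/oppr_inj/(root_of_unity_exprz_inj q0 q_root);
    rewrite ?normrN ?ht_act_le //.
  by rewrite -!actM E.
have orth v : pairing (r v *m crt j) (phi *m r w - phi *m r w') = 0.
  have /eqP := congr1 (fun z : int => z%:~R : R) (ht_eq v).
  rewrite -!phi_c_vec !(coroot_actP gcmA marks HW HS) c_vec_delta -!scalemxAr.
  rewrite !pairingZl !(rM HW) -!mulmxA => /eqP/mulfI Epair.
  rewrite pairingBr -!pairing_mulmx Epair ?subrr //.
  by rewrite gt_eqF // (c_gt0 HW HS).
(* Orthogonality spreads to the orbits of all coroots and is used at the orbit element given by the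
   inverse of [w']. *)
have {}orth i : pairing (crt i) (phi *m r (w * w'^-1)%g) = pairing (crt i) phi.
  have /eqP := orbit_span orth (lift ord0 i) w'^-1%g.
  rewrite pairingBr subr_eq0 -!pairing_mulmx !mulmxA -!(rM HW) mulgV (r1 HW).
  by rewrite mul1mx pairing_mulmx => /eqP.
apply/eqP; rewrite -(inj_eq (mulIg w'^-1%g)) mulgV; apply/eqP.
apply: (strictly_dominant_free gcmA indA marks HW (y := phi)) => i;
  by rewrite ?orth phiE invr_gt0 (c_gt0 HW HS).
Qed.

End Characters.

(** * The level 0 action takes its values in the Hecke group algebra *)

Section HeckeGroupAlgebra.
Variables (R : realType) (n : nat) (A : 'M[int]_n.+1) (a : 'I_n.+1 -> nat).
Hypotheses (gcmA : gcm A) (indA : indecomposable A) (marks : null_marks A a).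
Variables (W0 : finGroupType) (r : W0 -> 'M[R]_n.+1).
Hypothesis HW : finite_weyl_group A a r.
Variable c : 'rV[R]_n.+1 -> rat.
Hypothesis HS : reflection_spacing A a r c.
Local Notation rt i := (simple_root R (lift ord0 i)).
Local Notation sr i := (srefl R A (lift ord0 i)).
Local Notation refl := (refl A a r).
Local Notation delta := (delta R a).
Local Notation hga := (hecke_group_algebra A a r).

Lemma hecke_group_algebra_subalgebra : is_subalgebra hga.
Proof.
split=> [S [[S1 _ _] _] //|z X X' SX SX' S Ssub|X X' SX SX' S Ssub].
  by have [[_ lin _] _] := Ssub; apply: lin; [apply: SX | apply: SX'].
by have [[_ _ mul] _] := Ssub; apply: mul; [apply: SX | apply: SX'].
Qed.

Lemma subalgebraZ (S : set 'M[R[i]]_#|W0|) (z : R[i]) X :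
  is_subalgebra S -> S X -> S (z *: X).
Proof.
move=> [S1 lin _] SX; have S0 : S 0.
  by rewrite -(subrr 1%:M) addrC -scaleN1r; apply: lin.
by rewrite -[_ *: _]addr0; apply: lin.
Qed.

Lemma subalgebraB (S : set 'M[R[i]]_#|W0|) X X' :
  is_subalgebra S -> S X -> S X' -> S (X - X').
Proof. by move=> [_ lin _] SX SX'; rewrite addrC -scaleN1r; apply: lin. Qed.

Lemma subalgebraM (S : set 'M[R[i]]_#|W0|) X X' :
  is_subalgebra S -> S X -> S X' -> S (X *m X').
Proof. by case=> _ _; apply. Qed.

Lemma basis_opM (f g : W0 -> W0) :
  basis_op R f *m basis_op R g = basis_op R (g \o f).
Proof.
apply/row_matrixP => k; rewrite row_mul !rowK /group_vec -rowE rowK.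
by rewrite enum_rankK.
Qed.

Lemma eq_basis_op (f g : W0 -> W0) : f =1 g -> basis_op R f = basis_op R g.
Proof. by move=> fg; apply/row_matrixP => k; rewrite !rowK fg. Qed.

Lemma hga_s_op i : hga (s_op A a r (lift ord0 i)).
Proof. by move=> S [_ gen]; apply: gen; exists i; left. Qed.

Lemma hga_pi_op i : hga (pi_op A a r (lift ord0 i)).
Proof. by move=> S [_ gen]; apply: gen; exists i; right. Qed.

Lemma hga_rmul u : hga (basis_op R (fun w => w * u)%g).
Proof.
elim/(W0_ind gcmA HW): u => [|u i IH].
  rewrite (_ : basis_op R _ = 1%:M).
    by have [] := hecke_group_algebra_subalgebra.
  by apply/row_matrixP => k; rewrite rowK row1 mulg1 /group_vec enum_valK.
have := subalgebraM hecke_group_algebra_subalgebra IH (hga_s_op i).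
rewrite basis_opM; congr hga; apply: eq_basis_op => w /=.
by rewrite mulgA.
Qed.

(** The orbit of [rho_vee] stays in [h^0], so the test defining [pi_0] depends only on [alpha_0]
    modulo [delta]. *)
Lemma pairing_rho_delta u : pairing (r u *m rho_vee A r) delta = 0.
Proof.
rewrite pairing_mulmx (delta_r gcmA marks HW) pairingZl pairing_suml.
rewrite big_seq big1 ?mulr0 // => p.
rewrite mem_filter => /andP[_ /root_pairsP[v [m ->]]] /=.
by rewrite pairing_mulmx (delta_r gcmA marks HW) pairing_coroot_delta.
Qed.

(* On h^0 the root alpha_0 is a positive multiple of u(alpha_m). *)
Lemma simple_root0_conj : exists u m,
  [/\ cl a r (srefl R A ord0) = (u * refl m * u^-1)%g &
      forall x, pairing x delta = 0 ->
        (0 < pairing x (simple_root R ord0))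
          = (0 < pairing (r u^-1%g *m x) (rt m))].
Proof.
have [_ HSiff] := HS; have [+ _] := HSiff (srefl R A ord0).
case=> [|p [K [+]]].
  exists 1, ord0; split; last by rewrite invr1 mulr1 mul1r.
  by exists [::]; rewrite big_nil.
rewrite mem_filter => /andP[_ /root_pairsP[u [m Ep]]].
set d := _ * _; set al := simple_root R ord0 => Erefl.
have Emx : simple_coroot R A ord0 *m al = p.2 *m (p.1 - d *: delta).
  by apply: (can_inj (subKr 1)).
pose t := pairing p.2 al / 2.
have Eal : al = t *: (p.1 - d *: delta).
  have := congr1 (mulmx al) Emx; rewrite !mulmxA.
  rewrite [al *m simple_coroot _ _ _]mx11_scalar [al *m p.2]mx11_scalar.
  rewrite -/(pairing _ _) -/(pairing _ _) pairing_simple2 // !mul_scalar_mx.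
  by move=> E2; rewrite /t mulrC -scalerA -E2 scalerA mulVf ?scale1r ?pnatr_eq0.
have t0 : t != 0.
  apply/eqP => t0; have := congr1 (fun y : 'rV_n.+1 => y 0 ord0) Eal.
  by rewrite t0 scale0r !mxE eqxx; apply/eqP/oner_neq0.
have pairE x : pairing x delta = 0 ->
    pairing x al = t * pairing (r u^-1%g *m x) (rt m).
  move=> x0; rewrite Eal pairingZr pairingBr pairingZr x0 mulr0 subr0 Ep.
  by rewrite pairing_mulmx.
have clE : cl a r (srefl R A ord0) = (u * refl m * u^-1)%g.
  apply: (cl_unique HW) => x x0.
  rewrite Erefl reflection_mul pairingBr pairingZr x0 mulr0 subr0 Ep /=.
  rewrite !(rM HW) (r_refl HW) -!mulmxA reflection_mul mulmxBr mulmxA -(rM HW).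
  by rewrite mulgV (r1 HW) mul1mx -scalemxAr pairing_mulmx.
have [tpos|tneg] := ltP 0 t.
  by exists u, m; split=> // x x0; rewrite pairE // pmulr_rgt0.
(* For a negative factor [t], the extra reflection replaces [u(alpha_m)] by its opposite without
   changing the conjugate of [refl m]. *)
exists (u * refl m)%g, m; split=> [|x x0].
  by rewrite clE invMg -!mulgA mulKVg.
rewrite pairE // nmulr_rgt0; last by rewrite lt_neqAle t0.
have -> : (u * refl m)^-1%g = (refl m * u^-1)%g.
  by rewrite invMg; congr (_ * _)%g; apply/eqP;
    rewrite eq_invg_mul (refl_invol gcmA HW).
rewrite (rM HW) (r_refl HW) -mulmxA (pairing_mulmx (sr m)) mul_reflection.
rewrite pairing_simple2 // scaler_nat mulr2n opprD addrA subrr sub0r.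
by rewrite -scaleN1r pairingZr mulN1r oppr_gt0.
Qed.

(* Conjugating pi_m by right translations gives pi_0. *)
Lemma hga_pi_op0 : hga (pi_op A a r ord0).
Proof.
have [u [m [clE posE]]] := simple_root0_conj.
have sub := hecke_group_algebra_subalgebra.
have := subalgebraM sub (hga_rmul u) (hga_pi_op m).
move=> /(subalgebraM sub)/(_ (hga_rmul u^-1%g)).
rewrite !basis_opM; congr hga; apply: eq_basis_op => w /=.
rewrite posE ?pairing_rho_delta // mulmxA -(rM HW) -invMg clE.
by case: ifP => _; rewrite ?mulgK // -/(refl m) !mulgA.
Qed.

Variables (q1 q2 : R[i]) (H : algType R[i]) (T : 'I_n.+1 -> H).
Variables (rho : {lrmorphism H -> 'M[R[i]]_#|W0|}) (l : R).
Hypothesis HT : level0_representation A a r q1 q2 T rho.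

Lemma rho_scale (z : R[i]) (h : H) : rho (z *: h) = z *: (rho h : 'M_#|W0|).
Proof. exact: (linearZ_LR rho). Qed.

Lemma hga_rho_T i : hga (rho (T i)).
Proof.
have sub := hecke_group_algebra_subalgebra.
rewrite HT.
refine (subalgebraB sub (subalgebraZ _ sub _) (subalgebraZ _ sub _)).
  by case: (unliftP ord0 i) => [j|] ->; [exact: hga_pi_op | exact: hga_pi_op0].
exact: hga_rmul.
Qed.

Lemma rho_Tinv i : rho (Tinv q1 q2 T i) =
  (q1 * q2)^-1 *: ((q1 + q2) *: 1%:M - (rho (T i) : 'M_#|W0|)).
Proof.
apply: etrans (rho_scale _ _) _; congr (_ *: _).
apply: etrans (rmorphB rho _ _) _; congr (_ - _).
apply: etrans (rho_scale _ _) _; congr (_ *: _).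
exact: rmorph1 rho.
Qed.

Lemma hga_rho_Tinv i : hga (rho (Tinv q1 q2 T i)).
Proof.
have sub := hecke_group_algebra_subalgebra; rewrite rho_Tinv.
refine (subalgebraZ _ sub (subalgebraB sub _ (hga_rho_T i))).
refine (subalgebraZ _ sub _).
by case: sub.
Qed.

Lemma hga_rho_Y lam : hga (rho (Y A a q1 q2 T r c l lam)).
Proof.
have sub := hecke_group_algebra_subalgebra.
rewrite /Y rho_scale; refine (subalgebraZ _ sub _).
(* Walk and starting alcove are generalized: membership holds for every word and every choice of
   signs. *)
move: (xget _ _) (1 : 'M[R]_n.+1); elim=> [|i s IH] u /=.
  by rewrite rmorph1; case: sub.
rewrite rmorphM; refine (subalgebraM sub _ (IH _)).
by case: ifP => _; [exact: hga_rho_T | exact: hga_rho_Tinv].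
Qed.

End HeckeGroupAlgebra.

(** * Projections onto the lines of a joint eigenbasis with distinct characters *)

Section JointEigenbasis.
Variables (F : fieldType) (N : nat) (I : finType) (L : Type).
Variables (E : I -> 'rV[F]_N) (chi : I -> L -> F) (Z : L -> 'M[F]_N).
Hypotheses (E_basis : basis_of fullv (codom E)).
Hypothesis E_eigen : forall w lam, E w *m Z lam = chi w lam *: E w.
Hypothesis chi_inj : forall w w', w != w' ->
  exists lam, chi w lam != chi w' lam.

Lemma eigenbasis_neq0 w : E w != 0.
Proof.
have /andP[_ /free_not0 E0] := E_basis; apply/E0/codom_f.
Qed.

Lemma eigenbasis_sum x : exists k : I -> F, x = \sum_w k w *: E w.
Proof.
have : x \in <<codom E>>%VS by rewrite (span_basis E_basis) memvf.
rewrite -[codom E]/(tval (codom_tuple E)) => /coord_span Ex.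
exists (fun w => coord (codom_tuple E) (enum_rank w) x); rewrite {1}Ex.
rewrite (reindex enum_rank) /=; last first.
  by apply: onW_bij; apply: enum_rank_bij.
apply: eq_bigr => w _; congr (_ *: _).
by rewrite (nth_map w) ?nth_enum_rank // -cardE.
Qed.

Lemma eigenbasis_ext (X X' : 'M[F]_N) :
  (forall w, E w *m X = E w *m X') -> X = X'.
Proof.
move=> XX'; apply/row_matrixP => k; rewrite !rowE.
have [x ->] := eigenbasis_sum (delta_mx 0 k).
by rewrite !mulmx_suml; apply: eq_bigr => w _; rewrite -!scalemxAl XX'.
Qed.

Variable S : 'M[F]_N -> Prop.
Hypotheses (S1 : S 1%:M)
  (S_lin : forall z X X', S X -> S X' -> S (z *: X + X'))
  (SM : forall X X', S X -> S X' -> S (X *m X')).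
Hypothesis SZ : forall lam, S (Z lam).

(* The product of the factors [(Z lam - chi w' lam) / (chi w lam - chi w' lam)]
   with [lam] separating [w] from [w']. *)
Lemma eigenprojection w : exists2 p, S p &
  forall w', E w' *m p = if w' == w then E w' else 0.
Proof.
(* Invariant of the interpolation: [p] is diagonal in the basis [E], with eigenvalue 1 at [w] and 0
   at the indices already treated. *)
suff [p Sp [x [px xw xs]]] : exists2 p, S p & exists x : I -> F,
    [/\ forall w', E w' *m p = x w' *: E w', x w = 1 &
        forall w', w' \in rem w (enum I) -> x w' = 0].
  exists p => // w'; rewrite px; case: eqVneq => [->|ww'].
    by rewrite xw scale1r.
  by rewrite xs ?scale0r // mem_rem_uniq ?enum_uniq // inE ww' mem_enum.
have : w \notin rem w (enum I) by rewrite mem_rem_uniq ?enum_uniq // inE eqxx.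
elim: (rem w _) => [|v s IH].
  by exists 1%:M => //; exists (fun=> 1); split=> // w'; rewrite mulmx1 scale1r.
rewrite inE negb_or => /andP[wv /IH[p Sp [x [px xw xs]]]].
have [lam neq] := chi_inj wv.
have d0 : chi w lam - chi v lam != 0 by rewrite subr_eq0.
pose d := (chi w lam - chi v lam)^-1.
exists (p *m (d *: Z lam + (- (d * chi v lam) *: 1%:M))).
  apply: SM => //; apply: S_lin => //; rewrite -[X in S X]addr0.
  apply: S_lin => //.
  by have := S_lin (-1) S1 S1; rewrite scaleN1r addNr.
exists (fun w' => x w' * (d * (chi w' lam - chi v lam))); split=> [w'||w'].
- rewrite mulmxA px -scalemxAl -scalerA; congr (_ *: _).
  rewrite mulmxDr -!scalemxAr mulmx1 E_eigen.
  by rewrite scalerA -scalerDl mulrBr.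
- by rewrite xw mul1r mulVf.
- rewrite inE => /predU1P[->|/xs ->]; last by rewrite mul0r.
  by rewrite subrr !mulr0.
Qed.

Variable p : I -> 'M[F]_N.
Hypothesis Sp : forall w, S (p w).
Hypothesis pE : forall w w', E w' *m p w = if w' == w then E w' else 0.

Lemma eigenprojection_neq0 w : p w != 0.
Proof.
apply/eqP => pw0; have := pE w w; rewrite pw0 mulmx0 eqxx.
by move=> E0; have := eigenbasis_neq0 w; rewrite -E0 eqxx.
Qed.

Lemma eigenprojectionM w w' : p w *m p w' = if w == w' then p w else 0.
Proof.
apply: eigenbasis_ext => v; rewrite mulmxA pE.
case: (eqVneq v w) => [->|vw]; last first.
  by rewrite mul0mx; case: eqP; rewrite ?mulmx0 // pE (negPf vw).
by rewrite pE; case: eqP => _; rewrite ?mulmx0 // pE eqxx.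
Qed.

Lemma eigenprojection_sum : \sum_w p w = 1%:M.
Proof.
apply: eigenbasis_ext => v; rewrite mulmx_sumr mulmx1 (bigD1 v) //= pE eqxx.
by rewrite big1 ?addr0 // => w /negPf vw; rewrite pE eq_sym vw.
Qed.

Lemma eigenprojection_line w x : exists z, x *m p w = z *: E w.
Proof.
have [k ->] := eigenbasis_sum x; exists (k w).
rewrite mulmx_suml (bigD1 w) //= -scalemxAl pE eqxx.
rewrite big1 ?addr0 // => v /negPf vw.
by rewrite -scalemxAl pE vw scaler0.
Qed.

(* [e = p w e p w] preserves the line of [E w] and kills the other [E v], so it
   is a multiple of [p w]. *)
Lemma eigenprojection_primitive w e f : e != 0 -> f != 0 -> e *m e = e ->
  f *m f = f -> e *m f = 0 -> f *m e = 0 -> p w <> e + f.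
Proof.
move=> e0 f0 ee ff ef fe pw.
have pe : p w *m e = e by rewrite pw mulmxDl ee fe addr0.
have ep : e *m p w = e by rewrite pw mulmxDr ee ef addr0.
have [z Ez] := eigenprojection_line w (E w *m e).
rewrite -mulmxA ep in Ez.
have Ee : e = z *: p w.
  apply: eigenbasis_ext => v; rewrite -scalemxAr pE.
  case: eqP => [->|/eqP/negPf vw]; first by [].
  by rewrite -pe mulmxA pE vw mul0mx scaler0.
(* Idempotence leaves [z = 0] or [z = 1], that is, [e = 0] or [f = 0]. *)
have /eqP : (z * z - z) *: p w = 0.
  by rewrite scalerBl -Ee -ee Ee -scalemxAl -scalemxAr eigenprojectionM
    eqxx scalerA subrr.
rewrite scaler_eq0 (negPf (eigenprojection_neq0 w)) orbF.
rewrite -[X in _ - X]mulr1 -mulrBr mulf_eq0 subr_eq0 => /orP[/eqP z0|/eqP z1].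
  by rewrite Ee z0 scale0r eqxx in e0.
move: pw; rewrite Ee z1 scale1r -[X in X = _]addr0 => /addrI /esym/eqP.
exact/negP.
Qed.

(** The component of [x] along another [E v] is scaled by both characters, and these differ at some
    [lam], so it vanishes. *)
Lemma joint_eigenvector_line w x : (forall lam, x *m Z lam = chi w lam *: x) ->
  exists z, x = z *: E w.
Proof.
move=> x_eigen; have [z Ez] := eigenprojection_line w x; exists z.
rewrite -Ez -[LHS]mulmx1 -eigenprojection_sum mulmx_sumr (bigD1 w) //=.
rewrite big1 ?addr0 // => v vw; have [lam neq] := chi_inj vw.
have Zp : Z lam *m p v = chi v lam *: p v.
  apply: eigenbasis_ext => u; rewrite mulmxA E_eigen -scalemxAl -scalemxAr pE.
  by case: eqP => [->|_]; rewrite ?scaler0.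
have /eqP : (chi v lam - chi w lam) *: (x *m p v) = 0.
  rewrite scalerBl [chi w lam *: _]scalemxAl -x_eigen -mulmxA Zp -scalemxAr.
  by rewrite subrr.
by rewrite scaler_eq0 subr_eq0 (negPf neq) => /eqP.
Qed.

End JointEigenbasis.

(** * The maximal decomposition and the uniqueness of the eigenbasis up to rescaling *)

Theorem corollary7p4 (R : realType) (n : nat) (A : 'M[int]_n.+1)
    (a : 'I_n.+1 -> nat)
    (W0 : finGroupType) (r : W0 -> 'M[R]_n.+1)
    (c : 'rV[R]_n.+1 -> rat) (l : R) (theta : 'rV[int]_n)
    (q1 q2 : R[i])
    (H : algType R[i]) (T : 'I_n.+1 -> H)
    (rho : {lrmorphism H -> 'M[R[i]]_#|W0|})
    (E : W0 -> 'rV[R[i]]_#|W0|) :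
  (0 < n)%N ->
  gcm A -> indecomposable A -> affine_type R A -> null_marks A a ->
  finite_weyl_group A a r ->
  reflection_spacing A a r c ->
  0 < l ->
  highest_coroot A r theta ->
  q1 != 0 -> q2 != 0 ->
  (forall k : nat, (1 <= k)%N -> k%:Z <= 2 * ht theta ->
     (- (q1 / q2)) ^+ k != 1) ->
  affine_hecke_algebra A q1 q2 T ->
  level0_representation A a r q1 q2 T rho ->
  Y_eigenbasis A a r c l q1 q2 T rho E ->
  (exists p : W0 -> 'M[R[i]]_#|W0|,
     (forall w w', E w' *m p w = if w' == w then E w' else 0) /\
     maximal_idempotent_decomposition (hecke_group_algebra A a r) p) /\
  (forall E' : W0 -> 'rV[R[i]]_#|W0|,
     Y_eigenbasis A a r c l q1 q2 T rho E' ->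
     exists z : W0 -> R[i], forall w, z w != 0 /\ E' w = z w *: E w).
Proof.
move=> n_gt0 gcmA indA _ marks HW HS _ theta_max q1_neq0 q2_neq0 q_root _ HT.
set q := - (q1 / q2) in q_root *; move=> [E_basis E_eigen].
have q_neq0 : q != 0 by rewrite oppr_eq0 mulf_neq0 ?invr_neq0.
pose chi w lam := q ^ (- ht (coroot_act A a r c w lam)).
pose Z lam : 'M_#|W0| := rho (Y A a q1 q2 T r c l lam).
have chi_inj w w' : w != w' -> exists lam, chi w lam != chi w' lam.
  move=> /eqP ww'; apply: contrapT => /forallNP E0; apply: ww'.
  apply: (coroot_act_characters_inj gcmA indA marks HW HS theta_max n_gt0
    q_neq0) => // lam.
  by apply/eqP/negPn/negP/E0.
have sub := hecke_group_algebra_subalgebra A a r.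
have ZS lam : hecke_group_algebra A a r (Z lam).
  exact: (hga_rho_Y gcmA marks HW HS l HT lam).
have [S1 S_lin SM] := sub.
have [p pS pE] : exists2 p : W0 -> 'M_#|W0|,
    forall w, hecke_group_algebra A a r (p w) &
    forall w w', E w' *m p w = if w' == w then E w' else 0.
  have /choice[p pP] w : exists p, hecke_group_algebra A a r p /\
      forall w', E w' *m p = if w' == w then E w' else 0.
    have [p Sp pE] := eigenprojection (Z := Z) E_eigen chi_inj S1 S_lin SM ZS w.
    by exists p.
  by exists p => w; have [] := pP w.
split=> [|E' [E'_basis E'_eigen]].
  exists p; split=> //; split; first split=> [w|w|w w' /negPf ww'|].
  - by split; [exact: pS | apply: (eigenprojection_neq0 E_basis pE)].
  - by rewrite (eigenprojectionM E_basis pE) eqxx.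
  - by rewrite (eigenprojectionM E_basis pE) ww'.
  - exact: (eigenprojection_sum E_basis pE).
  - by move=> w e f _ _; apply: (eigenprojection_primitive E_basis pE).
have /choice[z zE] w : exists z, E' w = z *: E w.
  by apply: (joint_eigenvector_line E_basis E_eigen chi_inj pE).
(* The factors are non-zero because a basis contains no zero vector. *)
exists z => w; split=> //; apply/eqP => z0.
by have := eigenbasis_neq0 E'_basis w; rewrite zE z0 scale0r eqxx.
Qed.
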